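(* Let $((F,\nu,N),[\,,]_{F,h},(\rho,\eta))$ be a generalized Lie algebroid and let $(E,\pi,M)$ be an interior differential system of it. Suppose that for any $(U,\xi_U)\in[\mathcal A_M]$ there exists a basis $\{\Theta^{r+1},\dots,\Theta^{p}\}$ of the module of sections $\Gamma(E^{0}_{\mid U},\pi^{0},U)$ of the annihilator subbundle over $U$. Then $(E,\pi,M)$ is involutive if and only if (for each such $U$) there exist $$\Omega^{\alpha}_{\beta}\in\Lambda^{1}(h^{*}F_{\mid U},h^{*}\nu,U),\qquad \alpha,\beta\in\{r+1,\dots,p\},$$ such that $$d^{h^{*}F}\Theta^{\alpha}=\sum_{\beta=r+1}^{p}\Omega^{\alpha}_{\beta}\wedge\Theta^{\beta},\qquad \alpha\in\{r+1,\dots,p\}.$$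
   Context: Generalized Lie algebroids. Manifolds are smooth and $\mathcal F(N)$ is the ring of smooth real functions on $N$. Let $(F,\nu,N)$ be a vector bundle of rank $p$, $\eta:N\to M$ and $h:M\to N$ diffeomorphisms, and $(\rho,\eta)$ a vector bundle morphism from $(F,\nu,N)$ to $(TM,\tau_M,M)$. Let $\theta=\Gamma(Th\circ\rho,h\circ\eta):\Gamma(F,\nu,N)\to\Gamma(TN,\tau_N,N)$ be the induced $\mathcal F(N)$-module morphism, given in a local frame $(t_\alpha)$ of $F$ over $V\subseteq N$ and local coordinates $(x^i)$ on $U\subseteq h^{-1}(V)\subseteq M$ by $$\theta(z^\alpha t_\alpha)(f)=z^\alpha\rho^i_\alpha\Big(\frac{\partial (f\circ h)}{\partial x^i}\circ h^{-1}\Big),$$ where the $\rho^i_\alpha$ are the local component functions of $\rho$ (regarded as functions on $N$). It is a generalized Lie algebroid if there is a biadditive operation $[\,,]_{F,h}$ on $\Gamma(F,\nu,N)$ with $[u,u]_{F,h}=0$, the Jacobi identity, and $[u,fv]_{F,h}=f[u,v]_{F,h}+\theta(u)(f)\,v$ for $f\in\mathcal F(N)$. Locally $[t_\alpha,t_\beta]_{F,h}=L^\gamma_{\alpha\beta}t_\gamma$. Pull-back Lie algebroid. On the pull-back bundle $(h^*F,h^*\nu,M)$, with local frame $T_\alpha=t_\alpha\circ h$, one has the Lie algebroid structure over $M$ with anchor $Z^\alpha T_\alpha\mapsto Z^\alpha(\rho^i_\alpha\circ h)\frac{\partial}{\partial x^i}$ and bracket $[\,,]_{h^*F}$ determined by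 $[T_\alpha,fT_\beta]_{h^*F}=f(L^\gamma_{\alpha\beta}\circ h)T_\gamma+(\rho^i_\alpha\circ h)\frac{\partial f}{\partial x^i}T_\beta$ and $[fT_\alpha,T_\beta]_{h^*F}=-[T_\beta,fT_\alpha]_{h^*F}$. Write $\hat\rho$ for this anchor. $\Lambda^q(h^*F_{\mid U},h^*\nu,U)$ is the module of $q$-forms (alternating, function-multilinear) on sections of $h^*F$ over $U$; for $1$-forms $(\omega\wedge\theta)(S,T)=\omega(S)\theta(T)-\omega(T)\theta(S)$ and $d^{h^*F}\Theta(S,T)=\hat\rho(S)(\Theta(T))-\hat\rho(T)(\Theta(S))-\Theta([S,T]_{h^*F})$. $[\mathcal A_M]$ is the differentiable structure (set of charts $(U,\xi_U)$) of $M$, chosen so that each chart domain $U$ is also the domain of a local bundle chart. An interior differential system (IDS) of the generalized Lie algebroid is a vector subbundle $(E,\pi,M)$ of $(h^*F,h^*\nu,M)$. Its annihilator $(E^0,\pi^0,M)$ is the vector subbundle of the dual bundle of $h^*F$ with $\Gamma(E^0,\pi^0,M)=\{\Omega\mid\Omega(S)=0\ \forall S\in\Gamma(E,\pi,M)\}$. The IDS is called involutive if $[S,T]_{h^*F}\in\Gamma(E,\pi,M)$ for all $S,T\in\Gamma(E,\pi,M)$. Here $r$ is the rank of $E$ and $p$ the rank of $F$. *)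

(* Defs.v *)
From HB Require Import structures.
From mathcomp Require Import all_boot all_order all_algebra.
From mathcomp Require Import all_classical all_reals all_analysis.

Set Implicit Arguments.
Unset Strict Implicit.
Unset Printing Implicit Defensive.

Import Order.TTheory GRing.Theory Num.Theory.
Import numFieldNormedType.Exports.

Local Open Scope classical_set_scope.
Local Open Scope ring_scope.

(* Conventions.  A function, section or form over an open set U is represented
   by a total one; only its values on U are meaningful, so equality over U is
   equality at the points of U. *)

Fixpoint Ck (R : realType) (n : nat) (A : set 'rV[R]_n) (k : nat)
    (f : 'rV[R]_n -> R) : Prop :=
  match k with
  | 0 => forall z, A z -> {for z, continuous f}
  | k'.+1 => (forall z, A z -> differentiable f z) /\
      (forall i : 'I_n, Ck A k' (fun z => 'D_(delta_mx 0 i) f z))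
  end.

Definition Csmooth (R : realType) (n : nat) (A : set 'rV[R]_n)
    (f : 'rV[R]_n -> R) : Prop := forall k, Ck A k f.

Record chart (R : realType) (T : topologicalType) (n : nat) := Chart {
  cdom : set T;
  cmap :> T -> 'rV[R]_n;
  cinv : 'rV[R]_n -> T;
  cdom_open : open cdom;
  cimg_open : open (cmap @` cdom);
  cmapK : forall x, cdom x -> cinv (cmap x) = x;
  cmap_continuous : forall x, cdom x -> {for x, continuous cmap};
  cinv_continuous : forall x, cdom x -> {for cmap x, continuous cinv} }.

(* The atlas is a set of compatible charts that need not be maximal, so that
   its domains may be required to be trivializing for a bundle. *)
Record manifold (R : realType) := Manifold {
  mcar :> topologicalType;
  mdim : nat;
  matlas : set (chart R mcar mdim);
  matlas_cover : forall x, exists2 c, matlas c & cdom c x;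
  matlas_smooth : forall c d, matlas c -> matlas d -> forall j,
    Csmooth (c @` (cdom c `&` cdom d)) (fun z => d (cinv c z) 0 j);
  mhausdorff : hausdorff_space mcar;
  msecond_countable : @second_countable mcar }.

Arguments matlas {R} M _ : rename.

Section Smoothness.
Context {R : realType}.

Definition smooth_on (M : manifold R) (U : set M) (f : M -> R) : Prop :=
  forall c, matlas M c -> Csmooth (c @` (U `&` cdom c)) (f \o cinv c).

Definition smooth_near (M : manifold R) (x : M) (f : M -> R) : Prop :=
  exists U : set M, [/\ open U, U x & smooth_on U f].

Definition smooth_map (M N : manifold R) (g : M -> N) : Prop :=
  continuous g /\
  forall d, matlas N d -> forall j,
    smooth_on (g @^-1` cdom d) (fun x => d (g x) 0 j).

End Smoothness.

Record diffeo (R : realType) (M N : manifold R) := Diffeo {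
  dmap :> M -> N;
  dinv : N -> M;
  dmapK : cancel dmap dinv;
  dinvK : cancel dinv dmap;
  dmap_smooth : smooth_map dmap;
  dinv_smooth : smooth_map dinv }.

Definition partial (R : realType) (M : manifold R)
    (c : chart R M (mdim M)) (i : 'I_(mdim M)) (f : M -> R) (x : M) : R :=
  'D_(delta_mx 0 i) (f \o cinv c) (c x).

(* A tangent vector at x is the operator X^i d/dx^i on germs at x of smooth
   functions; it is given the value 0 on functions not smooth near x, so that
   two tangent vectors with the same components are equal as operators. *)
Record tangent (R : realType) (M : manifold R) (x : M) := Tangent {
  tact :> (M -> R) -> R;
  tact_out : forall f, ~ smooth_near x f -> tact f = 0;
  tact_coord : forall c, matlas M c -> cdom c x ->
    exists X : 'I_(mdim M) -> R, forall f, smooth_near x f ->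
      tact f = \sum_i X i * partial c i f x }.

(* A vector bundle is given by its fibres and a cocycle of local
   trivializations; this determines the smooth structure of the total space. *)
Record bchart (R : realType) (N : manifold R) (V : N -> lmodType R) (p : nat)
    := BChart {
  bdom : set N;
  btriv : forall y, V y -> 'rV[R]_p;
  btrivV : forall y, 'rV[R]_p -> V y;
  bdom_open : open bdom;
  btriv_linear : forall y, bdom y -> linear (@btriv y);
  btrivK : forall y, bdom y -> cancel (@btriv y) (@btrivV y);
  btrivVK : forall y, bdom y -> cancel (@btrivV y) (@btriv y) }.

Section BundleCharts.
Context {R : realType} {N : manifold R} {V : N -> lmodType R} {p : nat}.

Definition bframe (a : bchart V p) (i : 'I_p) (y : N) : V y :=
  btrivV a y (delta_mx 0 i).

Definition bcoord (a : bchart V p) (s : forall y, V y) (i : 'I_p) (y : N) : R :=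
  btriv a (s y) 0 i.

Definition btransition_smooth (a b : bchart V p) : Prop :=
  forall i j, smooth_on (bdom a `&` bdom b) (bcoord b (bframe a i) j).

(* b may be added to the bundle atlas A *)
Definition local_bundle_chart (A : set (bchart V p)) (b : bchart V p) : Prop :=
  forall a, A a -> btransition_smooth a b /\ btransition_smooth b a.

Definition smooth_section (A : set (bchart V p)) (U : set N)
    (s : forall y, V y) : Prop :=
  forall a, A a -> forall i, smooth_on (U `&` bdom a) (bcoord a s i).

End BundleCharts.

Record vbundle (R : realType) (N : manifold R) (p : nat) := VBundle {
  fibre :> N -> lmodType R;
  batlas : set (bchart fibre p);
  batlas_cover : forall y, exists2 a, batlas a & bdom a y;
  batlas_smooth : forall a b, batlas a -> batlas b -> btransition_smooth a b }.

Arguments batlas {R N p} F _ : rename.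

Definition gsection (R : realType) (N : manifold R) (p : nat)
    (F : vbundle N p) (u : forall y, F y) : Prop :=
  smooth_section (batlas F) setT u.

Record subbundle (R : realType) (N : manifold R) (V : N -> lmodType R)
    (p : nat) (A : set (bchart V p)) (r : nat) := Subbundle {
  sub_fibre :> forall y, set (V y);
  sub_frame : forall y0, exists (U : set N) (s : 'I_r -> forall y, V y),
    [/\ open U, U y0, forall i, smooth_section A U (s i) &
      forall y, U y ->
        (forall c : 'I_r -> R, \sum_i c i *: s i y = 0 -> forall i, c i = 0) /\
        (forall v : V y, @sub_fibre y v <->
          exists c : 'I_r -> R, v = \sum_i c i *: s i y)] }.

Arguments sub_fibre {R N V p A r} E y _ : rename.

Definition sub_section (R : realType) (N : manifold R) (V : N -> lmodType R)
    (p : nat) (A : set (bchart V p)) (r : nat) (E : subbundle A r)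
    (U : set N) (s : forall y, V y) : Prop :=
  smooth_section A U s /\ forall y, U y -> E y (s y).

Section PullbackBundle.
Context {R : realType} {M N : manifold R} {p : nat}.
Variables (F : vbundle N p) (h : diffeo M N).

Definition pb_fibre (x : M) : lmodType R := F (h x).

Definition pb_bchart (a : bchart F p) : bchart pb_fibre p.
Proof.
refine (@BChart R M pb_fibre p (h @^-1` bdom a)
  (fun x v => @btriv _ _ _ _ a (h x) v) (fun x z => btrivV a (h x) z) _ _ _ _).
- by apply: open_comp (bdom_open a) => x _; exact: (dmap_smooth h).1.
- by move=> x ax; exact: (btriv_linear ax).
- by move=> x ax; exact: (btrivK ax).
- by move=> x ax; exact: (btrivVK ax).
Defined.

Definition pb_atlas : set (bchart pb_fibre p) := pb_bchart @` batlas F.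

(* S o h^-1, as a section of F *)
Definition pb_push (S : forall x, pb_fibre x) (y : N) : F y :=
  eq_rect (h (dinv h y)) (fun w => F w : Type) (S (dinv h y)) y (dinvK h y).

End PullbackBundle.

Arguments pb_atlas {R M N p} F h _.
Arguments pb_push {R M N p} F h S y.

Section ModuleMorphism.
Context {R : realType} {M N : manifold R} {p : nat}.

Definition vb_morphism_to_tangent (F : vbundle N p) (eta : N -> M)
    (rho : forall y, F y -> tangent (eta y)) : Prop :=
  (forall y k (v w : F y) f,
     rho y (k *: v + w) f = k * rho y v f + rho y w f) /\
  (forall a c, batlas F a -> matlas M c -> forall alpha i,
     smooth_on (bdom a `&` eta @^-1` cdom c)
       (fun y => rho y (bframe a alpha y) (fun x => c x 0 i))).

(* Gamma(Th o rho, h o eta)(u), acting on a function f on N: the fibre of F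
   which is sent over y is the one over (h o eta)^-1 (y), and
   Th(X)(f) = X(f o h). *)
Definition theta_op (F : vbundle N p) (h : diffeo M N) (eta : diffeo N M)
    (rho : forall y, F y -> tangent (eta y))
    (u : forall y, F y) (f : N -> R) (y : N) : R :=
  rho _ (u (dinv eta (dinv h y))) (f \o h).

End ModuleMorphism.

Record genLieAlgebroid (R : realType) (M N : manifold R) (p : nat)
    (F : vbundle N p) := GenLieAlgebroid {
  gla_h : diffeo M N;
  gla_eta : diffeo N M;
  gla_rho : forall y, F y -> tangent (gla_eta y);
  gla_rho_morphism : vb_morphism_to_tangent gla_rho;
  (* theta is F(N)-linear; its additivity follows from that of rho *)
  gla_theta_linear : forall (g f : N -> R) (u : forall y, F y),
    smooth_on setT g -> smooth_on setT f -> gsection u ->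
    forall y, theta_op gla_h gla_rho (fun w => g w *: u w) f y =
              g y * theta_op gla_h gla_rho u f y;
  gla_br : (forall y, F y) -> (forall y, F y) -> (forall y, F y);
  gla_br_smooth : forall u v, gsection u -> gsection v -> gsection (gla_br u v);
  gla_br_addl : forall u u' v, gsection u -> gsection u' -> gsection v ->
    forall y, gla_br (fun w => u w + u' w) v y = gla_br u v y + gla_br u' v y;
  gla_br_addr : forall u v v', gsection u -> gsection v -> gsection v' ->
    forall y, gla_br u (fun w => v w + v' w) y = gla_br u v y + gla_br u v' y;
  gla_br_alt : forall u, gsection u ->
    forall y, gla_br u u y = 0;
  gla_br_jacobi : forall u v w, gsection u -> gsection v -> gsection w ->
    forall y, gla_br u (gla_br v w) y + gla_br v (gla_br w u) y
              + gla_br w (gla_br u v) y = 0;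
  gla_br_leibniz : forall (f : N -> R) u v, smooth_on setT f ->
    gsection u -> gsection v ->
    forall y, gla_br u (fun w => f w *: v w) y =
              f y *: gla_br u v y + theta_op gla_h gla_rho u f y *: v y }.

Section PullbackAlgebroid.
Context {R : realType} {M N : manifold R} {p : nat} {F : vbundle N p}.
Variable G : genLieAlgebroid M F.
Let h := gla_h G.
Let eta := gla_eta G.

Definition hF : M -> lmodType R := pb_fibre F h.
Definition hF_atlas : set (bchart hF p) := pb_atlas F h.

(* A global smooth section of F with the same germ at y as u (u itself if
   there is none). *)
Definition glob_ext (u : forall y, F y) (y : N) : forall w, F w :=
  if pselect (exists v : forall w, F w, gsection v /\
      \forall w \near y, v w = u w) is left e then projT1 (cid e) else u.

(* L^gamma_{alpha beta}(y), where [t_alpha, t_beta]_{F,h} = L^gamma t_gamma.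
   The bracket is an operation on global sections; by the Leibniz rule it is
   local, whence the value of the bracket of two local sections. *)
Definition structure_fun (a : bchart F p) (alpha beta gamma : 'I_p) (y : N) : R :=
  bcoord a (gla_br G (glob_ext (bframe a alpha) y)
                     (glob_ext (bframe a beta) y)) gamma y.

(* The anchor of h^*F applied to S, as a derivation of functions on M, that is
   Gamma(rho, eta)(S o h^-1).  F(N)-linearity of theta makes rho vanish over
   w whenever h (eta w) <> w, so that the value at x depends on S x only and
   equals S^alpha (rho^i_alpha o h) df/dx^i. *)
Definition hF_anchor (S : forall x, hF x) (f : M -> R) (x : M) : R :=
  gla_rho G (pb_push F h S (dinv eta x)) f.

Definition bchart_at (y : N) : bchart F p := s2val (cid2 (batlas_cover F y)).

(* [S, T]_{h^*F} at x, from [T_alpha, f T_beta] =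
   f (L^gamma_{alpha beta} o h) T_gamma + (rho^i_alpha o h) df/dx^i T_beta,
   [f T_alpha, T_beta] = - [T_beta, f T_alpha] and biadditivity, expanded on
   S = S^alpha T_alpha and T = T^beta T_beta in a frame T_alpha = t_alpha o h
   around x; the value does not depend on the frame. *)
Definition hF_bracket (S T : forall x, hF x) (x : M) : hF x :=
  let a := bchart_at (h x) in
  let b := pb_bchart h a in
  btrivV b x (\row_gamma
    (\sum_alpha \sum_beta bcoord b S alpha x * bcoord b T beta x *
        structure_fun a alpha beta gamma (h x)
     + hF_anchor S (bcoord b T gamma) x - hF_anchor T (bcoord b S gamma) x)).

Definition hF_form := (forall x, hF x) -> M -> R.

(* Lambda^1(h^*F_{|U}) *)
Definition one_form (U : set M) (w : hF_form) : Prop :=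
  [/\ forall S, smooth_section hF_atlas U S -> smooth_on U (w S),
      forall S T, smooth_section hF_atlas U S -> smooth_section hF_atlas U T ->
        (forall x, U x -> S x = T x) -> forall x, U x -> w S x = w T x &
      forall (f : M -> R) S T, smooth_on U f ->
        smooth_section hF_atlas U S -> smooth_section hF_atlas U T ->
        forall x, U x -> w (fun z => f z *: S z + T z) x = f x * w S x + w T x].

Definition wedge (w t : hF_form) (S T : forall x, hF x) (x : M) : R :=
  w S x * t T x - w T x * t S x.

Definition d_hF (t : hF_form) (S T : forall x, hF x) (x : M) : R :=
  hF_anchor S (t T) x - hF_anchor T (t S) x - t (hF_bracket S T) x.

End PullbackAlgebroid.

Arguments hF_atlas {R M N p F} G _.

Section IDS.
Context {R : realType} {M N : manifold R} {p : nat} {F : vbundle N p}.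
Variable G : genLieAlgebroid M F.

Definition IDS (r : nat) : Type := subbundle (hF_atlas G) r.

Context {r : nat}.
Variable E : IDS r.

Definition ids_involutive : Prop :=
  forall S T, sub_section E setT S -> sub_section E setT T ->
    sub_section E setT (hF_bracket S T).

(* Gamma(E^0_{|U}), sections of the dual of h^*F being identified with
   one-forms *)
Definition annihilator (U : set M) (w : hF_form G) : Prop :=
  one_form U w /\
  forall S, sub_section E U S -> forall x, U x -> w S x = 0.

(* basis of the module Gamma(E^0_{|U}) over the smooth functions on U *)
Definition annihilator_basis (U : set M) (I : finType)
    (Theta : I -> hF_form G) : Prop :=
  [/\ forall i, annihilator U (Theta i),
      forall w, annihilator U w -> exists f : I -> M -> R,
        (forall i, smooth_on U (f i)) /\
        forall S, smooth_section (hF_atlas G) U S ->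
          forall x, U x -> w S x = \sum_i f i x * Theta i S x &
      forall f : I -> M -> R, (forall i, smooth_on U (f i)) ->
        (forall S, smooth_section (hF_atlas G) U S ->
          forall x, U x -> \sum_i f i x * Theta i S x = 0) ->
        forall i x, U x -> f i x = 0].

End IDS.

(* Main.v *)
Require Import Defs.
From mathcomp Require Import all_boot all_order all_algebra.
From mathcomp Require Import all_classical all_reals all_analysis.
From mathcomp Require Import ring lra.
Set Implicit Arguments.
Unset Strict Implicit.
Unset Printing Implicit Defensive.
Import Order.TTheory GRing.Theory Num.Theory.
Import numFieldNormedType.Exports.
Local Open Scope classical_set_scope.
Local Open Scope ring_scope.

(** Two facts carry the proof: the differential of a one-form [t] satisfies
    [d t (S, T) = - t [S, T]] as soon as [t] vanishes on [S] and [T], and [E] is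
    the common kernel of the forms [Theta al] at every point.

    If [d Theta] lies in the ideal generated by the [Theta be], then
    [Theta al [S, T]] vanishes for sections [S], [T] of [E], hence [[S, T]] is in
    [E] ([bracket_in_subbundle]). Conversely, sections [X be] with
    [Theta al (X be) = delta] split every section [S] into a section [P S] of [E]
    and the combination of the [X be] with coefficients [Theta be S]; involutivity
    gives [d Theta al (P S, P T) = 0], and the bilinear expansion of this equation
    is the structure equation for
    [Omega al be S = d Theta al (S, X be)
       - 1/2 sum_ga d Theta al (X ga, X be) Theta ga S]
    ([exists_connection_forms]). As [E] need not have a frame over the chart
    domain, [Theta] cannot always be completed to a coframe there; the [X be]
    always exist, as the columns of [A^T (A A^T)^-1], where [A] is the matrix of
    the coefficients of [Theta] in a trivialisation.

    That [A] has full rank and that its kernel is [E] are pointwise statements,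
    obtained from the module-theoretic hypothesis on [Theta] by realising each
    covector which kills [E] at a point as the value of a section of the
    annihilator ([annihilator_value]); their number [p - r] then forces the
    independence of the [Theta al] at the point ([coframe_row_free]).

    Two facts about the pull-back algebroid are not formal. The anchor at [x] is
    given by a vector of [F] over [eta^-1 x], and it depends on the value at [x]
    only because the linearity of [theta] over the functions on [N] makes [rho]
    vanish over the points which [h \o eta] moves ([rho_eq0]). The bracket is
    given at each point by a formula in a frame chosen at that point; on global
    sections it is the bracket of [F] read through [h] ([hF_bracket_global]),
    whence its smoothness and its antisymmetry. The passage between local and
    global sections rests on bump functions ([exists_bump]), built from
    [exp (- 1 / t)]. *)

(** * Smooth functions on open sets of R^n *)

(** The difference [g - f], being null near [z], has differential [0] there. *)
Lemma near_differentiable (R : realType) (V W : normedModType R) (f g : V -> W)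
    (z : V) :
  (\forall w \near z, f w = g w) -> differentiable f z -> differentiable g z.
Proof.
move=> fg df; rewrite -(subrK f g); apply: differentiableD => //.
have h0 : (g - f) \o shift z = cst ((g - f) z) + \0 +o_ (0 : V) id.
  apply/eqaddoP => _/posnumP[e].
  have : \forall w \near (0 : V), f (w + z) = g (w + z).
    rewrite (near_shift z 0); apply: filterS fg => w /=.
    by rewrite sub0r addrNK.
  apply: filterS => w fgw /=.
  rewrite [X in `|X|](_ : _ = 0) ?normr0; last first.
    by rewrite !fctE /= -fgw (nbhs_singleton fg) !subrr /= addr0 subr0.
  by rewrite mulr_ge0.
apply/diff_locallyP; rewrite (diff_unique _ h0).
  by split=> // ?; exact: cst_continuous.
by move=> ?; exact: cst_continuous.
Qed.

Section Calculus.
Context {R : realType} {n : nat}.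
Implicit Types (A B : set 'rV[R]_n) (f g : 'rV[R]_n -> R) (k : nat).

(** The condition defining [Ck] is imposed point by point; this makes it local
    in [A]. *)
Lemma CkP A k f : Ck A k f <-> forall z, A z -> Ck [set z] k f.
Proof.
elim: k f => [|k IH] f /=.
  by split=> [h z Az _ ->|h z Az]; [exact: h|exact: (h z Az)].
split=> [[df h] z Az|h].
  split=> [_ ->|i]; first exact: df.
  by have /IH := h i; exact.
split=> [z Az|i]; first by have [d _] := h _ Az; exact: d.
by apply/IH => z Az; have [_] := h _ Az; exact.
Qed.

Lemma sub_Ck A B k f : A `<=` B -> Ck B k f -> Ck A k f.
Proof. by move=> AB /CkP h; apply/CkP => z /AB; exact: h. Qed.

Lemma CkW A k f : Ck A k.+1 f -> Ck A k f.
Proof.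
elim: k f => [|k IH] f [df h].
  by move=> z Az; apply: differentiable_continuous; exact: df.
by split=> // i; exact: IH.
Qed.

(** By induction on [k]: if two functions coincide near [z], so do their
    directional derivatives. *)
Lemma near_Ck z k f g :
  (\forall w \near z, f w = g w) -> Ck [set z] k f -> Ck [set z] k g.
Proof.
elim: k f g => [|k IH] f g fg /=.
  move=> cf _ ->; have cfz := cf _ erefl; rewrite /continuous_at in cfz *.
  move: cfz; rewrite /prop_for /continuous_at (nbhs_singleton fg : f z = g z).
  apply: cvg_trans.
  exact: (@near_eq_cvg _ _ (nbhs z) (nbhs_filter z) f g fg).
move=> [df h]; split=> [_ ->|i].
  have dfz := df _ erefl.
  exact: near_differentiable dfz.
apply: (IH ('D_(delta_mx 0 i) f)); last exact: h.
by move/near_join: fg; apply: filterS => w fg; exact: near_eq_derive.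
Qed.

Lemma eq_Ck A k f g : open A -> (forall z, A z -> f z = g z) ->
  Ck A k f -> Ck A k g.
Proof.
move=> oA fg /CkP h; apply/CkP => z Az; apply: near_Ck (h z Az).
by apply: filterS (open_nbhs_nbhs (conj oA Az)).
Qed.

Lemma Ck_cst A k (a : R) : Ck A k (fun=> a).
Proof.
elim: k a => [|k IH] a /=; first by move=> z _; exact: cst_continuous.
split=> [z _|i]; first exact: (@differentiable_cst _ _ _ a z).
rewrite (_ : 'D_(delta_mx 0 i) _ = fun=> 0) //.
by apply/funext => z; exact: derive_cst.
Qed.

Lemma CkD A k f g : open A -> Ck A k f -> Ck A k g -> Ck A k (f \+ g).
Proof.
move=> oA; elim: k f g => [|k IH] f g /=.
  by move=> cf cg z Az; apply: continuousD; [exact: cf|exact: cg].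
move=> [df hf] [dg hg]; split=> [z Az|i].
  by apply: (@differentiableD _ _ _ f g); [exact: df|exact: dg].
apply: (eq_Ck oA _ (IH _ _ (hf i) (hg i))) => z Az /=.
by rewrite -(@deriveD _ _ _ f g) //; apply: diff_derivable; [exact: df|exact: dg].
Qed.

Lemma CkM A k f g : open A -> Ck A k f -> Ck A k g -> Ck A k (f \* g).
Proof.
move=> oA; elim: k f g => [|k IH] f g /=.
  by move=> cf cg z Az; apply: continuousM; [exact: cf|exact: cg].
move=> Cf Cg; have [[df hf] [dg hg]] := (Cf, Cg); split=> [z Az|i].
  by apply: (@differentiableM _ _ f g); [exact: df|exact: dg].
apply: (eq_Ck oA _ (CkD oA (IH _ _ (CkW Cf) (hg i)) (IH _ _ (CkW Cg) (hf i)))).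
move=> z Az /=.
by rewrite (@deriveM _ _ f g) //; apply: diff_derivable; [exact: df|exact: dg].
Qed.

Lemma Ck_sum A k (I : Type) (s : seq I) (F : I -> 'rV[R]_n -> R) : open A ->
  (forall i, Ck A k (F i)) -> Ck A k (fun z => \sum_(i <- s) F i z).
Proof.
move=> oA h; elim: s => [|i s IH].
  by apply: (eq_Ck oA _ (Ck_cst A k 0)) => z _; rewrite big_nil.
by apply: (eq_Ck oA _ (CkD oA (h i) IH)) => z _; rewrite big_cons.
Qed.

Lemma derive_coord (i j : 'I_n) z :
  'D_(delta_mx 0 j) (fun w : 'rV[R]_n => w 0 i : R) z = (i == j)%:R.
Proof.
have /matrixP/(_ 0 i) := derive_mx (@derivable_id _ _ z (delta_mx 0 j : 'rV[R]_n)).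
by rewrite derive_id !mxE eqxx /= => <-.
Qed.

Lemma Ck_coord A k (i : 'I_n) : Ck A k (fun z => z 0 i).
Proof.
case: k => [|k] /=; first by move=> z _; exact: coord_continuous.
split=> [z _|j]; first exact: differentiable_coord.
rewrite (_ : 'D_(delta_mx 0 j) _ = (fun=> (i == j)%:R : R)); first exact: Ck_cst.
by apply/funext => z; exact: derive_coord.
Qed.

(** A family of functions of one variable that is stable under derivation up
    to products and linear combinations consists of smooth functions; here the
    derivative of [G m] is a combination of [G (s m)] and [G (t m)]. *)
Lemma Ck_comp_family (B : set R) (G : nat -> R -> R) (a b : nat -> R)
    (s t : nat -> nat) :
  (forall m x, B x ->
     is_derive x 1 (G m) (a m * G (s m) x + b m * G (t m) x)) ->
  forall A k f m, open A -> (forall z, A z -> B (f z)) ->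
    Ck A k f -> Ck A k (G m \o f).
Proof.
move=> dG A k f m oA AB; elim: k m => [|k IH] m.
  move=> cf z Az; apply: continuous_comp; first exact: cf.
  apply: differentiable_continuous; apply/derivable1_diffP.
  by have [] := dG m (f z) (AB _ Az).
move=> Cf; have [df hf] := Cf; split=> [z Az|i].
  apply: differentiable_comp; first by exact: (df _ Az).
  by apply/derivable1_diffP; have [] := dG m (f z) (AB _ Az).
have IHf m' := IH m' (CkW Cf).
have C c := Ck_cst A k c.
apply: (eq_Ck oA _ (CkM oA (CkD oA (CkM oA (C (a m)) (IHf (s m)))
                                   (CkM oA (C (b m)) (IHf (t m)))) (hf i))).
move=> z Az /=; have dm := dG m (f z) (AB _ Az).
have dGm : differentiable (G m) (f z) by apply/derivable1_diffP; case: dm.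
rewrite [RHS]deriveE; last exact: differentiable_comp (df _ Az) _.
rewrite (diff_comp (df _ Az) dGm) /= -(deriveE _ (df _ Az)).
rewrite deriv1E; last by case: dm.
by rewrite derive1E (@derive_val _ _ _ _ _ _ _ dm) /= mulrC.
Qed.

Lemma CkV A k f : open A -> (forall z, A z -> f z != 0) ->
  Ck A k f -> Ck A k (fun z => (f z)^-1).
Proof.
move=> oA f0; elim: k => [|k IH] Cf.
  by move=> z Az; apply: continuousV; [exact: f0|exact: Cf].
have [df hf] := Cf; split=> [z Az|i].
  by apply: differentiableV; [exact: df|exact: f0].
have IHf := IH (CkW Cf).
apply: (eq_Ck oA _ (CkM oA (CkM oA (Ck_cst A k (-1)) (CkM oA IHf IHf)) (hf i))).
move=> z Az /=; rewrite deriveV ?f0 //; last by apply/diff_derivable/df.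
by rewrite mulN1r expr2 invfM.
Qed.

End Calculus.

Lemma continuous_row (R : realType) (T : topologicalType) (m : nat)
    (P : T -> 'rV[R]_m) (z : T) :
  (forall j, {for z, continuous (fun w => P w 0 j)}) -> {for z, continuous P}.
Proof.
move=> cP A [Q nQ QA].
have : \forall w \near z, forall j, Q 0 j (P w 0 j).
  by apply: filter_forall => j; exact: cP (nQ 0 j).
by apply: filterS => w Qw; apply: QA => i j; rewrite ord1; exact: Qw.
Qed.

(** Induction on the order of differentiability, through the chain rule for
    partial derivatives. *)
Lemma Ck_comp (R : realType) (n m k : nat) (A : set 'rV[R]_n) (B : set 'rV[R]_m)
    (P : 'rV[R]_n -> 'rV[R]_m) (f : 'rV[R]_m -> R) :
  open A -> (forall z, A z -> B (P z)) ->
  (forall j, Ck A k (fun z => P z 0 j)) -> Ck B k f -> Ck A k (f \o P).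
Proof.
move=> oA AB; have PE : P = fun z => \sum_j P z 0 j *: delta_mx 0 j.
  by apply/funext => z; rewrite {1}[P z]row_sum_delta.
elim: k f => [|k IH] f.
  move=> cP cf z Az; apply: continuous_comp; last exact: cf (AB _ Az).
  by apply: continuous_row => j; exact: cP.
move=> CP Cf; have [df hf] := Cf.
have dPj j z : A z -> differentiable (fun z => P z 0 j) z.
  by have [d _] := CP j; exact: d.
have dP z : A z -> differentiable P z.
  move=> Az; rewrite PE.
  rewrite -(fct_sumE _ _ (fun j z => P z 0 j *: delta_mx 0 j)).
  by apply: differentiable_sum => j; apply: differentiableZl; exact: dPj.
split=> [z Az|i].
  by apply: differentiable_comp; [exact: dP|exact: df (AB _ Az)].
have CPk j : Ck A k (fun z => P z 0 j) by exact: CkW.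
have := Ck_sum (index_enum 'I_m) oA
  (fun j => CkM oA (IH _ CPk (hf j)) (proj2 (CP j) i)).
apply: (eq_Ck oA) => z Az /=.
rewrite [RHS]deriveE; last first.
  by apply: differentiable_comp; [exact: dP|exact: df (AB _ Az)].
rewrite diff_comp /=; [|exact: dP|exact: df (AB _ Az)].
rewrite -(deriveE _ (dP _ Az)) derive_mx; last exact: diff_derivable (dP _ Az).
rewrite [X in 'd f _ X]row_sum_delta linear_sum; apply: eq_bigr => j _.
by rewrite linearZ /= mxE -deriveE 1?mulrC//; exact: df (AB _ Az).
Qed.

(** * A smooth function vanishing on a half-line *)

(** The functions [t ^- m * exp (- 1 / t)], extended by [0]: a family closed
    under derivation that contains the classical smooth function vanishing on
    a half-line. *)
Definition flat {R : realType} (m : nat) (t : R) : R :=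
  if 0 < t then t ^- m * expR (- t^-1) else 0.

(** From [exp s >= s ^ m.+2 / m.+2!] at [s = 1 / t]; the quadratic bound
    yields the derivative [0] at the origin. *)
Lemma flat_le {R : realType} (m : nat) (t : R) :
  `|flat m t| <= (m.+2)`!%:R * t ^+ 2.
Proof.
rewrite /flat; case: ifPn => t0; last by rewrite normr0 mulr_ge0 ?ler0n ?sqr_ge0.
rewrite ger0_norm; last by rewrite mulr_ge0 ?expR_ge0 ?invr_ge0 ?exprn_ge0 ?ltW.
rewrite ler_pdivrMl ?exprn_gt0 // expRN.
have f0 : 0 < (m.+2)`!%:R :> R by rewrite ltr0n fact_gt0.
have E : (t^-1) ^+ m.+2 / (m.+2)`!%:R <= expR (t^-1).
  apply: le_trans (expR_ge1Dxn m.+1 _); last by rewrite invr_ge0 ltW.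
  by rewrite lerDr ler01.
rewrite mulrCA -exprD addn2 -[leRHS]invrK lef_pV2 ?posrE ?expR_gt0 //.
  by apply: le_trans E; rewrite invfM exprVn mulrC.
by rewrite invr_gt0 mulr_gt0 // exprn_gt0.
Qed.

(** The coefficient [1] gives the derivative the form expected by
    [Ck_comp_family]. *)
Lemma is_derive_flat {R : realType} (m : nat) (t : R) :
  is_derive t 1 (flat m) (- m%:R * flat m.+1 t + 1 * flat m.+2 t).
Proof.
have [t0|t0|->] := ltgtP t 0.
- rewrite /flat !ltNge !(ltW t0) /= !mulr0 addr0.
  apply: (near_eq_is_derive (f := cst 0)).
  by apply: filterS (lt_nbhsl t0) => s s0; rewrite ltNge (ltW s0).
- rewrite /flat t0.
  have tn0 : t != 0 by rewrite gt_eqF.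
  have tm0 : (@GRing.exp R ^~ m) t != 0 by rewrite expf_neq0.
  have d1 : is_derive t (1 : R) (fun s : R => (s ^+ m)^-1) (- m%:R * t ^- m.+1).
    have dX : is_derive t (1 : R) (@GRing.exp R ^~ m) (m%:R * t ^+ m.-1).
      apply: DeriveDef; first exact: exprn_derivable.
      case: m {tm0} => [|m]; last by rewrite exp_derive /GRing.scale /= mulr1.
      by rewrite mul0r; exact: derive_cst.
    apply: (is_derive_eq (is_deriveV (f := @GRing.exp R ^~ m) tm0 dX)).
    case: m tm0 {dX} => [|m] tm0; rewrite /GRing.scale /=.
      by rewrite oppr0 !mul0r mulr0.
    by rewrite !exprS; field; rewrite tn0 expf_neq0.
  have d0 : is_derive t (1 : R) (fun s : R => - s^-1) (t ^- 2).
    apply: (is_derive_eq (is_deriveN (is_deriveV (f := id) tn0 (is_derive_id t 1)))).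
    by rewrite scaleNr opprK /GRing.scale /= mulr1.
  have d2 : is_derive t (1 : R) (fun s : R => expR (- s^-1))
      (t ^- 2 * expR (- t^-1)).
    apply: (is_derive_eq (is_derive1_comp (is_derive_expR _) d0)).
    by rewrite mulrC.
  have d : is_derive t (1 : R) (fun s : R => s ^- m * expR (- s^-1))
      (- m%:R * (t ^- m.+1 * expR (- t^-1)) + 1 * (t ^- m.+2 * expR (- t^-1))).
    apply: (is_derive_eq (is_deriveM d1 d2)).
    rewrite /= /GRing.scale /= !exprS.
    by field; rewrite ?tn0 ?expf_neq0.
  apply: near_eq_is_derive d.
  by apply: filterS (lt_nbhsr t0) => s s0; rewrite s0.
- rewrite {2 3}/flat !ltxx !mulr0 addr0.
  have cv : h^-1 *: ((flat m \o shift 0) (h *: 1) - flat m 0)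
      @[h --> (0 : R)^'] --> (0 : R).
    apply/cvgr0Pnorm_le => e e0; near=> h.
    rewrite /= addr0 {2}/flat ltxx subr0 normrM /GRing.scale /= mulr1.
    have h0 : 0 < `|h| by rewrite normr_gt0; near: h; exact: nbhs_dnbhs_neq.
    rewrite normfV ler_pdivrMl //; apply: le_trans (flat_le _ _) _.
    rewrite -(real_normK (num_real h)) expr2 mulrA [_ * e]mulrC ler_pM2r //.
    have f0 : 0 < (m.+2)`!%:R :> R by rewrite ltr0n fact_gt0.
    rewrite -ler_pdivlMl // mulrC.
    by near: h; apply: dnbhs0_le; rewrite divr_gt0.
  apply: DeriveDef; first by apply/cvg_ex; exists 0.
  exact: cvg_lim cv.
Unshelve. all: by end_near. Qed.

(** * Smooth functions near a point of a manifold *)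

Lemma near_open (T : topologicalType) (x : T) (P : T -> Prop) :
  (\forall y \near x, P y) -> exists U, [/\ open U, U x & U `<=` P].
Proof.
move=> nP; exists (interior P); split; [exact: open_interior|exact: nP|].
exact: interior_subset.
Qed.

Section SmoothNear.
Context {R : realType} {M : manifold R}.
Implicit Types (x y : M) (U V : set M) (f g : M -> R).

Lemma chart_img_open (c : chart R M (mdim M)) U :
  open U -> open (c @` (U `&` cdom c)).
Proof.
move=> oU; rewrite openE => _ [x [Ux cx] <-]; rewrite /interior /=.
have nU : \forall z \near c x, U (cinv c z).
  apply: (cinv_continuous cx); rewrite (cmapK cx).
  by apply: open_nbhs_nbhs.
have nC : \forall z \near c x, (c @` cdom c) z.
  by apply: open_nbhs_nbhs; split; [exact: cimg_open|exists x].
apply: filterS2 nU nC => z /= Uz [y cy yz]; exists y => //.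
by split=> //; rewrite -(cmapK cy) yz.
Qed.

Lemma near_cinv (c : chart R M (mdim M)) x (P : M -> Prop) : cdom c x ->
  (\forall y \near x, P y) -> \forall z \near c x, P (cinv c z).
Proof.
by move=> cx nP; apply: (cinv_continuous cx); rewrite (cmapK cx).
Qed.

Lemma smooth_near_on U f : (forall x, U x -> smooth_near x f) -> smooth_on U f.
Proof.
move=> h c ac k; apply/CkP => _ [x [Ux cx] <-].
have [V [oV Vx /(_ c ac k)/CkP]] := h x Ux; apply.
by exists x.
Qed.

Lemma smooth_on_near U f x : open U -> U x -> smooth_on U f -> smooth_near x f.
Proof. by move=> oU Ux sf; exists U. Qed.

(** Rephrasing with the neighbourhood filter, by which finitely many such
    conditions can be combined. *)
Lemma smooth_nearP x f : smooth_near x f <-> \forall y \near x,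
  forall c, matlas M c -> cdom c y -> forall k, Ck [set c y] k (f \o cinv c).
Proof.
split=> [[U [oU Ux sf]]|h].
  apply: filterS (open_nbhs_nbhs (conj oU Ux)) => y Uy c ac cy k.
  have /CkP := sf c ac k; apply; by exists y.
have [U [oU Ux UP]] := near_open h; exists U; split=> // c ac k.
by apply/CkP => _ [y [Uy cy] <-]; exact: UP.
Qed.

Lemma near_smooth_near x f : smooth_near x f -> \forall y \near x, smooth_near y f.
Proof.
move=> [U [oU Ux sf]]; apply: filterS (open_nbhs_nbhs (conj oU Ux)) => y Uy.
by exists U.
Qed.

Lemma eq_smooth_near x f g :
  (\forall y \near x, f y = g y) -> smooth_near x f -> smooth_near x g.
Proof.
move=> /near_join fg /smooth_nearP sf; apply/smooth_nearP.
apply: filterS2 fg sf => y fg sf c ac cy k.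
by apply: near_Ck (sf c ac cy k); exact: near_cinv fg.
Qed.

Lemma smooth_near_continuous x f : smooth_near x f -> {for x, continuous f}.
Proof.
move=> [U [oU Ux sf]]; have [c ac cx] := matlas_cover x.
have cf : {for c x, continuous (f \o cinv c)}.
  by apply: (sf c ac 0%N); exists x.
move=> A; rewrite -{1}(cmapK cx) => /cf; rewrite /= => nA.
have := cmap_continuous cx nA.
apply: filterS2 (open_nbhs_nbhs (conj (cdom_open c) cx)) => y cy /=.
by rewrite (cmapK cy).
Qed.

Lemma smooth_near_op2 (op : R -> R -> R) x f g :
  (forall A k (u v : 'rV[R]_(mdim M) -> R), open A -> Ck A k u -> Ck A k v ->
     Ck A k (fun z => op (u z) (v z))) ->
  smooth_near x f -> smooth_near x g -> smooth_near x (fun y => op (f y) (g y)).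
Proof.
move=> opC [U [oU Ux sf]] [V [oV Vx sg]].
exists (U `&` V); split=> //; first exact: openI.
move=> c ac k; apply: opC; first exact/chart_img_open/openI.
  by apply: sub_Ck (sf c ac k) => _ [y [[Uy _] cy] <-]; exists y.
by apply: sub_Ck (sg c ac k) => _ [y [[_ Vy] cy] <-]; exists y.
Qed.

Lemma smooth_nearD x f g : smooth_near x f -> smooth_near x g ->
  smooth_near x (fun y => f y + g y).
Proof. by apply: (smooth_near_op2 (op := +%R)) => A k u v; exact: CkD. Qed.

Lemma smooth_nearM x f g : smooth_near x f -> smooth_near x g ->
  smooth_near x (fun y => f y * g y).
Proof. by apply: (smooth_near_op2 (op := *%R)) => A k u v; exact: CkM. Qed.

Lemma smooth_near_cst x (a : R) : smooth_near x (fun=> a).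
Proof.
by exists setT; split=> //; [exact: openT|move=> c ac k; exact: Ck_cst].
Qed.

Lemma smooth_nearN x f : smooth_near x f -> smooth_near x (fun y => - f y).
Proof.
move=> sf; apply: eq_smooth_near (smooth_nearM (smooth_near_cst x (-1)) sf).
by near=> y; rewrite mulN1r.
Unshelve. all: by end_near. Qed.

Lemma smooth_nearB x f g : smooth_near x f -> smooth_near x g ->
  smooth_near x (fun y => f y - g y).
Proof. by move=> sf sg; apply: smooth_nearD => //; exact: smooth_nearN. Qed.

Lemma smooth_near_sum x (I : Type) (s : seq I) (P : pred I) (F : I -> M -> R) :
  (forall i, smooth_near x (F i)) ->
  smooth_near x (fun y => \sum_(i <- s | P i) F i y).
Proof.
move=> h; elim: s => [|i s IH].
  apply: eq_smooth_near (smooth_near_cst x 0).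
  by near=> y; rewrite big_nil.
case Pi : (P i); last first.
  by apply: eq_smooth_near IH; near=> y; rewrite big_cons Pi.
apply: eq_smooth_near (smooth_nearD (h i) IH).
by near=> y; rewrite big_cons Pi.
Unshelve. all: by end_near. Qed.

Lemma smooth_near_prod x (I : Type) (s : seq I) (P : pred I) (F : I -> M -> R) :
  (forall i, smooth_near x (F i)) ->
  smooth_near x (fun y => \prod_(i <- s | P i) F i y).
Proof.
move=> h; elim: s => [|i s IH].
  apply: eq_smooth_near (smooth_near_cst x 1).
  by near=> y; rewrite big_nil.
case Pi : (P i); last first.
  by apply: eq_smooth_near IH; near=> y; rewrite big_cons Pi.
apply: eq_smooth_near (smooth_nearM (h i) IH).
by near=> y; rewrite big_cons Pi.
Unshelve. all: by end_near. Qed.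

Lemma smooth_nearV x f : f x != 0 -> smooth_near x f ->
  smooth_near x (fun y => (f y)^-1).
Proof.
move=> fx0 sf.
have nf : \forall y \near x, f y != 0.
  by apply: cvgr_neq0 fx0; exact: smooth_near_continuous.
have [U [oU Ux UP]] := near_open (filterI (near_smooth_near sf) nf).
exists U; split=> // c ac k; apply: CkV; first exact: chart_img_open.
  by move=> _ [y [Uy cy] <-] /=; rewrite (cmapK cy); case: (UP _ Uy).
by apply: (@smooth_near_on U) => // y /UP[].
Qed.

Lemma smooth_near_flat x f m : smooth_near x f ->
  smooth_near x (fun y => flat m (f y)).
Proof.
move=> [U [oU Ux sf]]; exists U; split=> // c ac k.
apply: (@Ck_comp_family _ _ setT flat (fun m => - m%:R) (fun=> 1) S (S \o S)) => //.
- by move=> m' t _; exact: is_derive_flat.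
- exact: chart_img_open.
- exact: sf.
Qed.

(** This form of the chain rule covers both the composition with a map between
    manifolds, read in a chart of the target, and the smoothness of a function
    given by its expression in a chart. *)
Lemma smooth_near_comp_row (m : nat) x (P : M -> 'rV[R]_m) (A : set 'rV[R]_m)
    (F : 'rV[R]_m -> R) : open A -> A (P x) -> Csmooth A F ->
  (forall j, smooth_near x (fun y => P y 0 j)) -> smooth_near x (F \o P).
Proof.
move=> oA APx sF sP.
have cP : {for x, continuous P}.
  by apply: continuous_row => j; exact: smooth_near_continuous (sP j).
have nA : \forall y \near x, A (P y) by apply: cP; exact: open_nbhs_nbhs.
have nP : \forall y \near x, forall j, smooth_near y (fun y => P y 0 j).
  by apply: filter_forall => j; exact: near_smooth_near.
have [U [oU Ux UP]] := near_open (filterI nA nP).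
exists U; split=> // c ac k.
apply: (@Ck_comp _ _ _ _ _ A (P \o cinv c)) (sF k).
- exact: chart_img_open.
- by move=> _ [y [Uy cy] <-] /=; rewrite (cmapK cy); case: (UP _ Uy).
- move=> j; apply: (@smooth_near_on U (fun y => P y 0 j)) => // y /UP[_]; exact.
Qed.

Lemma smooth_near_coord c x j : matlas M c -> cdom c x ->
  smooth_near x (fun y => c y 0 j).
Proof.
move=> ac cx; exists (cdom c); split=> //; first exact: cdom_open.
move=> d ad; have := matlas_smooth ad ac j.
by rewrite setIC.
Qed.

End SmoothNear.

Lemma smooth_near_comp (R : realType) (M N : manifold R) (g : M -> N)
    (x : M) (f : N -> R) :
  smooth_map g -> smooth_near (g x) f -> smooth_near x (f \o g).
Proof.
move=> [cg sg] [U [oU Ux sf]]; have [d ad dx] := matlas_cover (g x).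
have nd : \forall y \near x, cdom d (g y).
  by apply: cg; apply: open_nbhs_nbhs; split => //; exact: cdom_open.
have sF : smooth_near x ((f \o cinv d) \o (fun y => d (g y))).
  apply: (smooth_near_comp_row (A := d @` (U `&` cdom d))).
  - exact: chart_img_open.
  - by exists (g x).
  - exact: sf.
  - move=> j; exists (g @^-1` cdom d); split=> //.
    by apply: open_comp (cdom_open d) => y _; exact: cg.
    exact: sg.
apply: eq_smooth_near sF; apply: filterS nd => y dy /=.
by rewrite (cmapK dy).
Qed.

(** * Bump functions *)

Section Bump.
Context {R : realType} {M : manifold R}.

(** The first term is positive for [q < s], the second one for [q > s / 4]. *)
Lemma bump_denom_neq0 (s q : R) : 0 < s -> flat 0 (s - q) + flat 0 (q - s / 4) != 0.
Proof.
move=> s0; have flat_ge0 t : 0 <= flat 0 t :> R.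
  by rewrite /flat; case: ifP => // _; rewrite mulr_ge0 ?expR_ge0 // invr_ge0.
have flat_gt0 t : 0 < t -> 0 < flat 0 t :> R.
  by rewrite /flat => ->; rewrite mulr_gt0 ?expR_gt0 // invr_gt0.
have [qs|sq] := ltP q s.
  by rewrite gt_eqF // ltr_wpDr // flat_gt0 // subr_gt0.
rewrite gt_eqF // ltr_wpDl // flat_gt0 //; lra.
Qed.

(** In a chart [c] around [x], with [q] the squared distance to [x], the bump is
    [flat (s - q) / (flat (s - q) + flat (q - s / 4))]; its support is contained
    in the preimage of a compact ball, which is closed as [M] is Hausdorff, so
    that it can be extended by zero. *)
Lemma exists_bump (x : M) (W : set M) : open W -> W x ->
  exists phi : M -> R, [/\ forall y, smooth_near y phi,
    \forall y \near x, phi y = 1 &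
    forall y, ~ W y -> \forall z \near y, phi z = 0].
Proof.
move=> oW Wx; have [c ac cx] := matlas_cover x.
pose A := c @` (W `&` cdom c).
have oA : open A by exact: chart_img_open.
have : nbhs (c x) A by apply: open_nbhs_nbhs; split=> //; exists x.
move=> /nbhs_ballP[r r0 rA].
pose d (z : 'rV[R]_(mdim M)) := \sum_j (z 0 j - c x 0 j) ^+ 2.
(* Half of [r ^+ 2], so that the closed ball lies in the open one. *)
pose s := r ^+ 2 / 2.
have s0 : 0 < s by rewrite divr_gt0 // exprn_gt0.
pose B := [set z | d z <= s].
have cd : continuous d.
  move=> z; have := @Ck_sum R _ setT 0 _ (index_enum 'I_(mdim M))
    (fun j z => (z 0 j - c x 0 j) * (z 0 j - c x 0 j)) openT.
  rewrite (_ : (fun _ => \sum_(_ <- _) _) = d); last first.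
    by apply/funext => w; apply: eq_bigr => j _; rewrite expr2.
  apply => // j; apply: CkM; first exact: openT.
    by apply: CkD; [exact: openT|exact: Ck_coord|exact: Ck_cst].
  by apply: CkD; [exact: openT|exact: Ck_coord|exact: Ck_cst].
have Bball z : B z -> forall j, `|z 0 j - c x 0 j| < r.
  move=> Bz j; rewrite -(ltr_pXn2r (n := 2)) ?nnegrE // ?ltW //.
  rewrite real_normK ?num_real //; apply: (@le_lt_trans _ _ s).
    apply: le_trans Bz; rewrite /d (bigD1 j) //= lerDl sumr_ge0 // => i _.
    exact: sqr_ge0.
  by rewrite /s ltr_pdivrMr // mulr2n mulrDr mulr1 ltrDl exprn_gt0.
have BA : B `<=` A.
  move=> z Bz; apply: rA; split=> // i j; rewrite ord1 /ball /= distrC; exact: Bball.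
have cB : compact B.
  apply: bounded_closed_compact; last first.
    by apply: (@closed_comp _ _ d [set t | t <= s]) => // ? _; exact: cd.
  exists (`|c x| + r); split; first exact: num_real.
  move=> u ru z Bz; apply: le_trans (ltW ru).
  rewrite -[z](subrK (c x)) addrC; apply: le_trans (ler_normD _ _) _.
  rewrite lerD2l /Num.Def.normr /= mx_normrE; apply: bigmax_le; first exact: ltW.
  by move=> [i j] _ /=; rewrite ord1 !mxE; apply/ltW/Bball.
pose K := cinv c @` B.
have KW : K `<=` W `&` cdom c.
  by move=> _ [z /BA[y [Wy cy] <-] <-]; rewrite (cmapK cy).
have cK : closed K.
  apply: compact_closed; first exact: mhausdorff.
  apply: continuous_compact => //; apply: continuous_in_subspaceT => z.
  rewrite inE => /BA[y [_ cy] <-]; exact: cinv_continuous.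
pose G y := flat 0 (s - d (c y)) / (flat 0 (s - d (c y)) + flat 0 (d (c y) - s / 4)).
have GK y : cdom c y -> ~ K y -> G y = 0.
  move=> cy nK; rewrite /G [X in X / _](_ : _ = 0) ?mul0r // /flat.
  rewrite ltNge subr_le0 ifF //; apply/negbTE; rewrite negbK.
  case: (leP s (d (c y))) => // /ltW dB; exfalso; apply: nK.
  by exists (c y) => //; rewrite (cmapK cy).
pose phi y := if `[< cdom c y >] then G y else 0.
have phi0 y : ~ K y -> phi y = 0.
  by move=> nK; rewrite /phi; case: asboolP => // cy; exact: GK.
have nphi0 y : ~ K y -> \forall z \near y, phi z = 0.
  move=> nK; have : nbhs y (~` K).
    by apply: open_nbhs_nbhs; split => //; exact: closed_openC.
  by apply: filterS => z; exact: phi0.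
have nphiG y : cdom c y -> \forall z \near y, G z = phi z.
  move=> cy; apply: filterS (open_nbhs_nbhs (conj (cdom_open c) cy)) => z cz.
  by rewrite /phi asboolT.
exists phi; split.
- move=> y; have [cy|ncy] := pselect (cdom c y); last first.
    apply: eq_smooth_near (smooth_near_cst y 0).
    have /nphi0 : ~ K y by move=> /KW[].
    by apply: filterS => z ->.
  apply: eq_smooth_near (nphiG _ cy) _.
  have sd : smooth_near y (fun z => d (c z)).
    apply: smooth_near_sum => j; rewrite /GRing.exp /=.
    by apply: smooth_nearM; (apply: smooth_nearB;
      [exact: smooth_near_coord|exact: smooth_near_cst]).
  have s1 : smooth_near y (fun z => flat 0 (s - d (c z))).
    by apply/smooth_near_flat/smooth_nearB => //; exact: smooth_near_cst.
  have s2 : smooth_near y (fun z => flat 0 (d (c z) - s / 4)).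
    by apply/smooth_near_flat/smooth_nearB => //; exact: smooth_near_cst.
  apply: smooth_nearM => //; apply: smooth_nearV; last exact: smooth_nearD.
  exact: bump_denom_neq0.
- have nd : \forall y \near x, d (c y) < s / 4.
    have cdx : d (c y) @[y --> x] --> d (c x).
      apply: (@cvg_comp _ _ _ c d); last exact: cd.
      exact: cmap_continuous.
    apply: cvgr_lt cdx _ _; rewrite [d _]big1 => [|j _]; first by rewrite divr_gt0.
    by rewrite subrr expr0n.
  apply: filterS2 nd (nphiG _ cx) => y dy <-; rewrite /G.
  have f0 : flat 0 (d (c y) - s / 4) = 0.
    by rewrite /flat ltNge subr_le0 (ltW dy).
  rewrite -[X in _ / X]/(_ + _) f0 addr0 divff //.
  by have := bump_denom_neq0 (d (c y)) s0; rewrite f0 addr0.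
- by move=> y nW; apply: nphi0 => /KW[].
Qed.

(** The product with a bump function, smooth on both sides of the boundary of
    the domain of [f]. *)
Lemma ext_function (x : M) (f : M -> R) : smooth_near x f ->
  exists g, (forall y, smooth_near y g) /\ \forall y \near x, g y = f y.
Proof.
move=> [U [oU Ux sf]]; have [phi [sphi phi1 phi0]] := exists_bump oU Ux.
exists (fun y => phi y * f y); split=> [y|].
  have [Uy|nUy] := pselect (U y).
    by apply: smooth_nearM => //; exists U.
  apply: eq_smooth_near (smooth_near_cst y 0).
  by apply: filterS (phi0 y nUy) => z ->; rewrite mul0r.
by apply: filterS phi1 => y ->; rewrite mul1r.
Qed.

End Bump.

(** * Tangent vectors as derivations *)

Section Tangent.
Context {R : realType} {M : manifold R} {x : M}.
Implicit Types (v : tangent x) (f g : M -> R).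

Lemma smooth_near_differentiable c f : matlas M c -> cdom c x ->
  smooth_near x f -> differentiable (f \o cinv c) (c x).
Proof.
move=> ac cx [U [oU Ux sf]]; have [df _] := sf c ac 1%N.
by apply: df; exists x.
Qed.

Lemma near_partial c i f g : cdom c x -> (\forall y \near x, f y = g y) ->
  partial c i f x = partial c i g x.
Proof.
by move=> cx fg; apply: near_eq_derive; exact: near_cinv fg.
Qed.

Lemma partial_cst c i (a : R) : partial c i (fun=> a) x = 0.
Proof. exact: derive_cst. Qed.

Lemma partialD c i f g : matlas M c -> cdom c x ->
  smooth_near x f -> smooth_near x g ->
  partial c i (fun y => f y + g y) x = partial c i f x + partial c i g x.
Proof.
move=> ac cx sf sg; rewrite /partial.
by rewrite -(@deriveD _ _ _ (f \o cinv c) (g \o cinv c)) //;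
  apply: diff_derivable; exact: smooth_near_differentiable.
Qed.

Lemma partialM c i f g : matlas M c -> cdom c x ->
  smooth_near x f -> smooth_near x g ->
  partial c i (fun y => f y * g y) x = f x * partial c i g x + g x * partial c i f x.
Proof.
move=> ac cx sf sg; rewrite /partial.
rewrite (_ : _ \o _ = (f \o cinv c) * (g \o cinv c)) //.
rewrite deriveM; [|apply: diff_derivable; exact: smooth_near_differentiable..].
by rewrite /= (cmapK cx).
Qed.

Lemma partial_coord c i j : matlas M c -> cdom c x ->
  partial c i (fun y => c y 0 j) x = (j == i)%:R.
Proof.
move=> ac cx; rewrite /partial -(derive_coord j i (c x)); apply: near_eq_derive.
have : nbhs (c x) (c @` cdom c).
  by apply: open_nbhs_nbhs; split; [exact: cimg_open|exists x].
by apply: filterS => _ [y cy <-] /=; rewrite (cmapK cy).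
Qed.

(** The components of a tangent vector are its values on the coordinate
    functions, as [partial c i] of the [j]-th coordinate is [1] or [0]. *)
Lemma tactE v c f : matlas M c -> cdom c x -> smooth_near x f ->
  v f = \sum_i v (fun y => c y 0 i) * partial c i f x.
Proof.
move=> ac cx sf; have [X XE] := tact_coord v ac cx.
rewrite XE //; apply: eq_bigr => i _; congr (_ * _).
rewrite XE; last exact: smooth_near_coord.
rewrite (bigD1 i) //= partial_coord // eqxx mulr1 big1 ?addr0 // => j ji.
by rewrite partial_coord // eq_sym (negbTE ji) mulr0.
Qed.

(** Outside the germs of smooth functions the equality holds because both
    values are [0] by convention. *)
Lemma near_tact v f g : (\forall y \near x, f y = g y) -> v f = v g.
Proof.
move=> fg; have [c ac cx] := matlas_cover x.
have [sf|nsf] := pselect (smooth_near x f).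
  have sg : smooth_near x g := eq_smooth_near fg sf.
  rewrite (tactE v ac cx sf) (tactE v ac cx sg).
  by apply: eq_bigr => i _; rewrite (near_partial i cx fg).
rewrite !tact_out // => sg; apply: nsf; apply: eq_smooth_near sg.
by apply: filterS fg => y ->.
Qed.

Lemma tact_cst v (a : R) : v (fun=> a) = 0.
Proof.
have [c ac cx] := matlas_cover x; rewrite (tactE v ac cx); last exact: smooth_near_cst.
by rewrite big1 // => i _; rewrite partial_cst mulr0.
Qed.

Lemma tactD v f g : smooth_near x f -> smooth_near x g ->
  v (fun y => f y + g y) = v f + v g.
Proof.
move=> sf sg; have [c ac cx] := matlas_cover x.
rewrite !(tactE v ac cx) //; last exact: smooth_nearD.
by rewrite -big_split; apply: eq_bigr => i _; rewrite partialD // mulrDr.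
Qed.

Lemma tactM v f g : smooth_near x f -> smooth_near x g ->
  v (fun y => f y * g y) = f x * v g + g x * v f.
Proof.
move=> sf sg; have [c ac cx] := matlas_cover x.
rewrite !(tactE v ac cx) //; last exact: smooth_nearM.
rewrite !mulr_sumr -big_split; apply: eq_bigr => i _ /=.
by rewrite partialM // mulrDr !(mulrCA (v _)).
Qed.

End Tangent.

(** * Smooth sections in local frames *)

Section BundleSections.
Context {R : realType} {N : manifold R} {V : N -> lmodType R} {p : nat}.
Implicit Types (a b : bchart V p) (s t : forall y, V y) (y : N).

Lemma btriv_lin a y k (v w : V y) : bdom a y ->
  btriv a (k *: v + w) = k *: btriv a v + btriv a w.
Proof. by move=> ay; exact: (btriv_linear ay). Qed.

Lemma btriv0 a y : bdom a y -> btriv a (0 : V y) = 0.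
Proof.
move=> ay; have := btriv_lin 1 0 0 ay; rewrite scale1r addr0 scale1r.
by move/eqP; rewrite -subr_eq0 opprD addNKr oppr_eq0 => /eqP.
Qed.

Lemma btrivD a y (v w : V y) : bdom a y -> btriv a (v + w) = btriv a v + btriv a w.
Proof. by move=> ay; have := btriv_lin 1 v w ay; rewrite !scale1r. Qed.

Lemma btrivZ a y k (v : V y) : bdom a y -> btriv a (k *: v) = k *: btriv a v.
Proof. by move=> ay; have := btriv_lin k v 0 ay; rewrite btriv0 // !addr0. Qed.

Lemma btriv_sum a y (I : Type) (r : seq I) (P : pred I) (F : I -> V y) : bdom a y ->
  btriv a (\sum_(i <- r | P i) F i) = \sum_(i <- r | P i) btriv a (F i).
Proof.
move=> ay; apply: (big_morph (@btriv _ _ _ _ a y)) => [v w|].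
  exact: btrivD.
exact: btriv0.
Qed.

Lemma btriv_inj a y (v w : V y) : bdom a y -> btriv a v = btriv a w -> v = w.
Proof. by move=> ay; exact: can_inj (btrivK ay) v w. Qed.

Lemma bcoord_frame a i j y : bdom a y -> bcoord a (bframe a i) j y = (j == i)%:R.
Proof. by move=> ay; rewrite /bcoord /bframe (btrivVK ay) mxE. Qed.

Lemma frame_expand a (y : N) (v : V y) : bdom a y ->
  v = \sum_i btriv a v 0 i *: bframe a i y.
Proof.
move=> ay; apply: (btriv_inj ay); rewrite btriv_sum // {1}[btriv a v]row_sum_delta.
by apply: eq_bigr => i _; rewrite btrivZ // /bframe (btrivVK ay).
Qed.

Lemma bcoord_trans a b s j y : bdom a y -> bdom b y ->
  bcoord b s j y = \sum_i bcoord a s i y * bcoord b (bframe a i) j y.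
Proof.
move=> ay dby; rewrite /bcoord {1}(frame_expand (s y) ay) btriv_sum // summxE.
by apply: eq_bigr => i _; rewrite btrivZ // mxE.
Qed.

Variable A : set (bchart V p).

(** Pointwise form of smoothness, in which the open set of definition does not
    appear. *)
Definition section_near (y : N) (s : forall y, V y) :=
  forall a, A a -> bdom a y -> forall i, smooth_near y (bcoord a s i).

Lemma smooth_sectionP U s : open U ->
  smooth_section A U s <-> forall y, U y -> section_near y s.
Proof.
move=> oU; split=> [h y Uy a Aa ay i|h a Aa i].
  apply: (@smooth_on_near _ _ (U `&` bdom a)) (h a Aa i) => //.
  exact/openI/bdom_open.
by apply: smooth_near_on => y [Uy ay]; exact: h.
Qed.

Lemma near_bdom a y : bdom a y -> \forall z \near y, bdom a z.
Proof. by move=> ay; apply: open_nbhs_nbhs; split=> //; exact: bdom_open. Qed.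

Lemma eq_section_near y s t : (\forall z \near y, s z = t z) ->
  section_near y s -> section_near y t.
Proof.
move=> st hs a Aa ay i; apply: eq_smooth_near (hs a Aa ay i).
by apply: filterS st => z; rewrite /bcoord => ->.
Qed.

Lemma section_near_lin y (f : N -> R) s t : smooth_near y f ->
  section_near y s -> section_near y t -> section_near y (fun z => f z *: s z + t z).
Proof.
move=> sf hs ht a Aa ay i.
apply: eq_smooth_near (smooth_nearD (smooth_nearM sf (hs a Aa ay i)) (ht a Aa ay i)).
by apply: filterS (near_bdom ay) => z az; rewrite /bcoord btriv_lin // !mxE.
Qed.

Lemma section_near0 y : section_near y (fun=> 0).
Proof.
move=> a Aa ay i; apply: eq_smooth_near (smooth_near_cst y 0).
by apply: filterS (near_bdom ay) => z az; rewrite /bcoord btriv0 // mxE.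
Qed.

Arguments section_near0 y : clear implicits.

Lemma section_nearZ y (f : N -> R) s : smooth_near y f ->
  section_near y s -> section_near y (fun z => f z *: s z).
Proof.
move=> sf hs; apply: (eq_section_near _ (section_near_lin sf hs (section_near0 y))).
by near=> z; rewrite addr0.
Unshelve. all: by end_near. Qed.

Lemma section_nearD y s t :
  section_near y s -> section_near y t -> section_near y (fun z => s z + t z).
Proof.
move=> hs ht.
apply: (eq_section_near _ (section_near_lin (smooth_near_cst y 1) hs ht)).
by near=> z; rewrite scale1r.
Unshelve. all: by end_near. Qed.

Lemma section_near_sum y (I : Type) (r : seq I) (F : I -> forall z, V z) :
  (forall i, section_near y (F i)) -> section_near y (fun z => \sum_(i <- r) F i z).
Proof.
move=> h; elim: r => [|i r IH].
  apply: (eq_section_near _ (section_near0 y)).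
  by near=> z; rewrite big_nil.
apply: (eq_section_near _ (section_nearD (h i) IH)).
by near=> z; rewrite big_cons.
Unshelve. all: by end_near. Qed.

Hypothesis Acover : forall y, exists2 a, A a & bdom a y.

Lemma section_near_coord b y s i : local_bundle_chart A b -> bdom b y ->
  section_near y s -> smooth_near y (bcoord b s i).
Proof.
move=> lb dby hs; have [a Aa ay] := Acover y.
have ts j : smooth_near y (bcoord b (bframe a j) i).
  apply: (@smooth_on_near _ _ (bdom a `&` bdom b)) => //.
    by apply: openI; exact: bdom_open.
  by case: (lb a Aa) => + _; exact.
apply: eq_smooth_near
  (smooth_near_sum _ _ (fun j => smooth_nearM (hs a Aa ay j) (ts j))).
apply: filterS2 (near_bdom ay) (near_bdom dby) => z az bz.
by rewrite (bcoord_trans _ _ az bz).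
Qed.

(** Smoothness can be tested in a single chart, by smoothness of the
    transition functions. *)
Lemma coord_section_near b y s : local_bundle_chart A b -> bdom b y ->
  (forall i, smooth_near y (bcoord b s i)) -> section_near y s.
Proof.
move=> lb dby hs a Aa ay i.
have ts j : smooth_near y (bcoord a (bframe b j) i).
  apply: (@smooth_on_near _ _ (bdom b `&` bdom a)) => //.
    by apply: openI; exact: bdom_open.
  by case: (lb a Aa) => _; exact.
apply: eq_smooth_near
  (smooth_near_sum _ _ (fun j => smooth_nearM (hs j) (ts j))).
apply: filterS2 (near_bdom ay) (near_bdom dby) => z az bz.
by rewrite (bcoord_trans _ _ bz az).
Qed.

Lemma frame_section_near b y i : local_bundle_chart A b -> bdom b y ->
  section_near y (bframe b i).
Proof.
move=> lb dby; apply: (coord_section_near lb dby) => j.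
apply: eq_smooth_near (smooth_near_cst y ((j == i)%:R)).
by apply: filterS (near_bdom dby) => z bz; rewrite bcoord_frame.
Qed.

Hypothesis Alocal : forall a, A a -> local_bundle_chart A a.

Lemma near_section_near y s : section_near y s ->
  \forall z \near y, section_near z s.
Proof.
move=> hs; have [a Aa ay] := Acover y.
have nsm : \forall z \near y, forall i, smooth_near z (bcoord a s i).
  by apply: filter_forall => i; exact: near_smooth_near (hs a Aa ay i).
apply: filterS2 (near_bdom ay) nsm => z az sz.
exact: coord_section_near (Alocal Aa) az sz.
Qed.

(** The product with a function vanishing outside of [U] is smooth on both
    sides of the boundary of [U]. *)
Lemma cutoff_section (U : set N) (phi : N -> R) s :
  (forall y, smooth_near y phi) ->
  (forall y, ~ U y -> \forall z \near y, phi z = 0) ->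
  (forall y, U y -> section_near y s) ->
  forall y, section_near y (fun z => phi z *: s z).
Proof.
move=> sphi phi0 sU y; have [Uy|nUy] := pselect (U y).
  by apply: section_nearZ => //; exact: sU.
apply: (eq_section_near _ (section_near0 y)).
by apply: filterS (phi0 y nUy) => z ->; rewrite scale0r.
Qed.

Lemma ext_section y s : section_near y s ->
  exists t, (forall z, section_near z t) /\ \forall z \near y, t z = s z.
Proof.
move=> /near_section_near/near_open[U [oU Uy sU]].
have [phi [sphi phi1 phi0]] := exists_bump oU Uy.
exists (fun z => phi z *: s z); split; first exact: cutoff_section phi0 sU.
by apply: filterS phi1 => z ->; rewrite scale1r.
Qed.

End BundleSections.

(** * Pull-back of sections, and the anchor *)

Section Pullback.
Context {R : realType} {M N : manifold R} {p : nat}.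
Variables (F : vbundle N p) (h : diffeo M N).

Lemma batlas_local a : batlas F a -> local_bundle_chart (batlas F) a.
Proof. by move=> Fa b Fb; split; apply: batlas_smooth. Qed.

Lemma pb_cover x : exists2 b, pb_atlas F h b & bdom b x.
Proof.
by have [a Fa ax] := batlas_cover F (h x); exists (pb_bchart h a) => //; exists a.
Qed.

(** The transition functions of the pull-back bundle are those of [F] composed
    with [h]. *)
Lemma pb_bchart_transition a b : batlas F a -> batlas F b ->
  btransition_smooth (pb_bchart h a) (pb_bchart h b).
Proof.
move=> Fa Fb i j; apply: smooth_near_on => x [ax bx].
apply: (@smooth_near_comp _ _ _ h x (bcoord b (bframe a i) j)).
  exact: dmap_smooth.
apply: (@smooth_on_near _ _ (bdom a `&` bdom b)) (batlas_smooth Fa Fb i j) => //.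
by apply: openI; exact: bdom_open.
Qed.

Lemma pb_local b : pb_atlas F h b -> local_bundle_chart (pb_atlas F h) b.
Proof.
by move=> [a Fa <-] _ [b' Fb' <-]; split; exact: pb_bchart_transition.
Qed.

(** [pb_push] moves vectors along [h (h^-1 y) = y]; this lemma and the next
    two compute through that transport. *)
Lemma btriv_transport (a : bchart F p) y y' (e : y = y') (v : F y) :
  btriv a (eq_rect y (fun w => F w : Type) v y' e) = btriv a v.
Proof. by case: _ / e. Qed.

Lemma transport_lin y y' (e : y = y') k (v w : F y) :
  eq_rect y (fun w => F w : Type) (k *: v + w) y' e =
  k *: eq_rect y (fun w => F w : Type) v y' e +
  eq_rect y (fun w => F w : Type) w y' e.
Proof. by case: _ / e. Qed.

Lemma transport_section (u : forall y, F y) y y' (e : y = y') :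
  eq_rect y (fun w => F w : Type) (u y) y' e = u y'.
Proof. by case: _ / e. Qed.

Lemma pb_push_bcoord a S i y :
  bcoord a (pb_push F h S) i y = bcoord (pb_bchart h a) S i (Defs.dinv h y).
Proof. by rewrite /bcoord /pb_push btriv_transport. Qed.

Lemma pb_push_lin (f : M -> R) S T y :
  pb_push F h (fun z => f z *: S z + T z) y =
  f (Defs.dinv h y) *: pb_push F h S y + pb_push F h T y.
Proof. by rewrite /pb_push transport_lin. Qed.

Lemma eq_pb_push S T y : S (Defs.dinv h y) = T (Defs.dinv h y) ->
  pb_push F h S y = pb_push F h T y.
Proof. by rewrite /pb_push => ->. Qed.

Lemma pb_push_comp (u : forall y, F y) : pb_push F h (fun x => u (h x)) = u.
Proof.
by apply: functional_extensionality_dep => y; exact: transport_section.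
Qed.

Lemma pb_push_section_near S y : section_near (pb_atlas F h) (Defs.dinv h y) S ->
  section_near (batlas F) y (pb_push F h S).
Proof.
move=> hS a Fa ay i.
have ahy : bdom (pb_bchart h a) (Defs.dinv h y) by rewrite /= dinvK.
have Pa : pb_atlas F h (pb_bchart h a) by exists a.
have := smooth_near_comp (dinv_smooth h) (hS _ Pa ahy i).
by apply: eq_smooth_near; near=> z; rewrite /= pb_push_bcoord.
Unshelve. all: by end_near. Qed.

Lemma pb_section_near (u : forall y, F y) x : section_near (batlas F) (h x) u ->
  section_near (pb_atlas F h) x (fun z => u (h z)).
Proof.
move=> hu _ [a Fa <-] ax i.
exact: smooth_near_comp (dmap_smooth h) (hu a Fa ax i).
Qed.

Lemma gsectionP (u : forall y, F y) :
  gsection u <-> forall y, section_near (batlas F) y u.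
Proof.
apply: iff_trans (smooth_sectionP _ _ openT) _.
by split=> [hu y|hu y _]; exact: hu.
Qed.

(** The section with constant coordinates near [y], made global. *)
Lemma section_value y (v : F y) : exists u, gsection u /\ u y = v.
Proof.
have [a Fa ay] := batlas_cover F y.
have hs : section_near (batlas F) y (fun z => \sum_i btriv a v 0 i *: bframe a i z).
  apply: section_near_sum => i; apply: section_nearZ; first exact: smooth_near_cst.
  exact: frame_section_near (batlas_local Fa) ay.
have [t [ht /nbhs_singleton ty]] :=
  ext_section (batlas_cover F) batlas_local hs.
by exists t; split; [exact/gsectionP|rewrite ty -frame_expand].
Qed.

End Pullback.

Section Anchor.
Context {R : realType} {M N : manifold R} {p : nat} {F : vbundle N p}.
Variable G : genLieAlgebroid M F.
Let h := gla_h G.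
Let eta := gla_eta G.
Let rho := gla_rho G.
Implicit Types (S T : forall x, hF G x) (f g : M -> R) (x : M).

(** The value of [theta u] at [h (eta y)] is computed from [u y]: when the two
    points differ, multiplying [u] by a function equal to [1] at [y] and to [0]
    at [h (eta y)] changes nothing on one side of the linearity of [theta] and
    gives [0] on the other. *)
Lemma rho_eq0 y (v : F y) f : h (eta y) <> y -> rho v f = 0.
Proof.
move=> hy; have [sf|nsf] := pselect (smooth_near (eta y) f); last exact: tact_out.
have [g [sg gf]] := ext_function sf; rewrite -(near_tact (rho v) gf).
have oW : open (~` [set h (eta y)]).
  by apply/closed_openC/accessible_closed_set1/hausdorff_accessible/mhausdorff.
have [phi [sphi /nbhs_singleton phi1 phi0]] := exists_bump oW (nesym hy).
have [u [su uy]] := section_value v.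
have sgh : smooth_on setT (g \o Defs.dinv h).
  by apply: smooth_near_on => z _; exact: smooth_near_comp (dinv_smooth h) _.
have sp : smooth_on setT phi by apply: smooth_near_on => z _; exact: sphi.
have := gla_theta_linear G sp sgh su (h (eta y)).
have /nbhs_singleton -> : \forall z \near h (eta y), phi z = 0.
  by apply: phi0 => /=; apply.
rewrite mul0r /theta_op -/h -/eta.
rewrite (_ : (g \o Defs.dinv h) \o h = g); last first.
  by apply/funext => z /=; rewrite dmapK.
by rewrite !dmapK phi1 scale1r uy.
Qed.

(** Either [h (eta y) = y] for [y = eta^-1 x], and then [S] is evaluated at
    [x], or both sides vanish by [rho_eq0]. *)
Lemma hF_anchor_lin f S T g x :
  hF_anchor (fun z => f z *: S z + T z) g x =
  f x * hF_anchor S g x + hF_anchor T g x.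
Proof.
rewrite /hF_anchor -/h -/eta pb_push_lin.
have [hy|hy] := pselect (h (eta (Defs.dinv eta x)) = Defs.dinv eta x); last first.
  by rewrite !(rho_eq0 _ _ hy) mulr0 addr0.
rewrite (gla_rho_morphism G).1; congr (_ * _ + _).
by rewrite -{1}hy dmapK dinvK.
Qed.

(** The same alternative as for [hF_anchor_lin] shows that the anchor is
    tensorial in the section. *)
Lemma eq_hF_anchor S T g x : S x = T x -> hF_anchor S g x = hF_anchor T g x.
Proof.
move=> ST; rewrite /hF_anchor -/h -/eta.
have [hy|hy] := pselect (h (eta (Defs.dinv eta x)) = Defs.dinv eta x); last first.
  by rewrite !(rho_eq0 _ _ hy).
have hx : Defs.dinv h (Defs.dinv eta x) = x by rewrite -{1}hy dmapK dinvK.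
by rewrite (@eq_pb_push _ _ _ _ _ _ S T) // hx.
Qed.

Lemma hF_anchor_sum (I : Type) (r : seq I) (k : I -> R) (T : I -> forall x, hF G x)
    S g x : S x = \sum_(i <- r) k i *: T i x ->
  hF_anchor S g x = \sum_(i <- r) k i * hF_anchor (T i) g x.
Proof.
elim: r S => [|i r IH] S.
  rewrite !big_nil => S0; have := hF_anchor_lin (fun=> -1) S S g x.
  rewrite mulN1r addNr => <-; apply: eq_hF_anchor.
  by rewrite scaleN1r addNr S0.
rewrite !big_cons => Sx.
rewrite (@eq_hF_anchor S (fun z => k i *: T i z + \sum_(j <- r) k j *: T j z)) //.
by rewrite (hF_anchor_lin (fun=> k i)); congr (_ + _); exact: IH.
Qed.

Lemma near_hF_anchor S f g x : (\forall y \near x, f y = g y) ->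
  hF_anchor S f x = hF_anchor S g x.
Proof. by move=> fg; apply: near_tact; rewrite dinvK. Qed.

Lemma hF_anchor_cst S (k : R) x : hF_anchor S (fun=> k) x = 0.
Proof. exact: tact_cst. Qed.

Lemma hF_anchorD S f g x : smooth_near x f -> smooth_near x g ->
  hF_anchor S (fun y => f y + g y) x = hF_anchor S f x + hF_anchor S g x.
Proof. by move=> sf sg; apply: tactD; rewrite dinvK. Qed.

Lemma hF_anchorM S f g x : smooth_near x f -> smooth_near x g ->
  hF_anchor S (fun y => f y * g y) x =
  f x * hF_anchor S g x + g x * hF_anchor S f x.
Proof.
move=> sf sg; have at_x (k : M -> R) : k x = k (eta (Defs.dinv eta x)).
  by rewrite dinvK.
rewrite (at_x f) (at_x g).
by apply: tactM; rewrite dinvK.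
Qed.

Lemma smooth_near_partial c i x f : matlas M c -> cdom c x ->
  smooth_near x f -> smooth_near x (partial c i f).
Proof.
move=> ac cx [U [oU Ux sf]].
apply: (smooth_near_comp_row (A := c @` (U `&` cdom c)) (P := c)
  (F := 'D_(delta_mx 0 i) (f \o cinv c))).
- exact: chart_img_open.
- by exists x.
- by move=> k; have [_] := sf c ac k.+1; exact.
- by move=> j; exact: smooth_near_coord.
Qed.

(** In coordinates the anchor is the sum of the [S^al rho^i_al df/dx^i]; after
    replacing [S] by a global extension, its coordinates may be read in a
    chart around [eta^-1 x], where the components of [rho] are smooth. *)
Lemma smooth_near_hF_anchor S f x : section_near (hF_atlas G) x S ->
  smooth_near x f -> smooth_near x (hF_anchor S f).
Proof.
move=> hS sf.
have [S' [hS' S'S]] := ext_section (pb_cover F h) (@pb_local _ _ _ _ F h) hS.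
have [c ac cx] := matlas_cover x.
have [a Fa ay] := batlas_cover F (Defs.dinv eta x).
have seta := dinv_smooth eta.
pose r alpha i y := rho (bframe a alpha y) (fun z => c z 0 i).
pose q alpha := bcoord a (pb_push F h S') alpha.
have sr alpha i : smooth_near x (r alpha i \o Defs.dinv eta).
  apply: smooth_near_comp => //.
  apply: (@smooth_on_near _ _ (bdom a `&` eta @^-1` cdom c)).
  - apply: openI; first exact: bdom_open.
    by apply: open_comp (cdom_open c) => ? _; exact: (dmap_smooth eta).1.
  - by split=> //=; rewrite dinvK.
  - exact: (gla_rho_morphism G).2.
have sq alpha : smooth_near x (q alpha \o Defs.dinv eta).
  apply: smooth_near_comp => //.
  exact: pb_push_section_near (hS' _) a Fa ay alpha.
apply: eq_smooth_near (smooth_near_sum (index_enum _) predT (fun i => smooth_nearM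
  (smooth_near_sum (index_enum _) predT (fun al => smooth_nearM (sq al) (sr al i)))
  (smooth_near_partial i ac cx sf))).
have na : \forall y \near x, bdom a (Defs.dinv eta y).
  by apply: (seta.1 x); exact: near_bdom.
have nc : \forall y \near x, cdom c y.
  by apply: open_nbhs_nbhs; split=> //; exact: cdom_open.
near=> y.
have ayy : bdom a (Defs.dinv eta y) by near: y.
have cy : cdom c y by near: y.
have sfy : smooth_near y f by near: y; exact: near_smooth_near.
have <- : hF_anchor S' f y = hF_anchor S f y.
  by apply: eq_hF_anchor; near: y.
rewrite /hF_anchor (@tactE _ _ _ _ c) ?dinvK //.
apply: eq_bigr => i _; congr (_ * _); last by rewrite (dinvK eta).
rewrite {1}(frame_expand (pb_push F h S' (Defs.dinv eta y)) ayy).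
rewrite -/rho /q /r /=.
elim: (index_enum _) => [|al s IH].
  rewrite !big_nil; have := (gla_rho_morphism G).1 (Defs.dinv eta y) (-1) 0 0.
  by move=> /(_ (fun z => c z 0 i)); rewrite scaler0 addr0 mulN1r addNr.
by rewrite !big_cons (gla_rho_morphism G).1 IH.
Unshelve. all: by end_near. Qed.

End Anchor.

(** * The bracket of the pull-back algebroid *)

Section Bracket.
Context {R : realType} {M N : manifold R} {p : nat} {F : vbundle N p}.
Variable G : genLieAlgebroid M F.
Let h := gla_h G.
Let br := gla_br G.
Let theta := theta_op h (gla_rho G).
Implicit Types (u v w : forall y, F y) (f g : N -> R) (y : N).

(** The two operators agree by definition, [u] being the push-forward of its
    own pull-back. *)
Lemma theta_opE u f y : theta u f y =
  hF_anchor (G := G) (fun x => u (h x)) (f \o h) (Defs.dinv h y).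
Proof. by rewrite /hF_anchor pb_push_comp. Qed.

Lemma gsection_lin f u v : (forall y, smooth_near y f) -> gsection u ->
  gsection v -> gsection (fun y => f y *: u y + v y).
Proof.
move=> sf /gsectionP hu /gsectionP hv; apply/gsectionP => y.
exact: section_near_lin.
Qed.

Lemma gsection0 : gsection (fun y => 0 : F y).
Proof. by apply/gsectionP => y; exact: section_near0. Qed.

Lemma gsectionZ f u : (forall y, smooth_near y f) -> gsection u ->
  gsection (fun y => f y *: u y).
Proof.
by move=> sf /gsectionP hu; apply/gsectionP => y; exact: section_nearZ.
Qed.

Lemma gsectionD u v : gsection u -> gsection v -> gsection (fun y => u y + v y).
Proof.
by move=> /gsectionP hu /gsectionP hv; apply/gsectionP => y; exact: section_nearD.
Qed.

Lemma gsection_sum (I : Type) (r : seq I) (f : I -> N -> R)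
    (w : I -> forall y, F y) : (forall i y, smooth_near y (f i)) ->
  (forall i, gsection (w i)) -> gsection (fun y => \sum_(i <- r) f i y *: w i y).
Proof.
move=> sf hw; apply/gsectionP => y; apply: section_near_sum => i.
by apply: section_nearZ => //; have /gsectionP := hw i; exact.
Qed.

Lemma br_leibniz f u v y : (forall z, smooth_near z f) -> gsection u -> gsection v ->
  br u (fun z => f z *: v z) y = f y *: br u v y + theta u f y *: v y.
Proof.
by move=> sf su sv; apply: gla_br_leibniz => //; apply: smooth_near_on => z _.
Qed.

Lemma br0r u y : gsection u -> br u (fun=> 0) y = 0.
Proof.
move=> su; have := br_leibniz y (fun z => smooth_near_cst z 0) su gsection0.
rewrite scale0r scaler0 addr0 => <-; congr (br u _ y).
by apply: functional_extensionality_dep => z; rewrite scale0r.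
Qed.

Lemma br_antisym u v y : gsection u -> gsection v -> br u v y = - br v u y.
Proof.
move=> su sv; have suv := gsectionD su sv.
have := gla_br_alt G suv y.
rewrite gla_br_addl // !gla_br_addr // !gla_br_alt // add0r addr0.
by move/eqP; rewrite addr_eq0 => /eqP.
Qed.

(** Locality of the bracket, from the Leibniz rule applied to the product of
    [v - v'] with a bump function: that product vanishes everywhere. *)
Lemma near_br_r u v v' y : gsection u -> gsection v -> gsection v' ->
  (\forall z \near y, v z = v' z) -> br u v y = br u v' y.
Proof.
move=> su sv sv' /near_open[U [oU Uy UP]].
have [phi [sphi phi1 phi0]] := exists_bump oU Uy.
(* Of the form [f *: u + v], for which the stability of sections is stated. *)
pose w z := -1 *: v' z + v z.
have sw : gsection w by apply: gsection_lin => // z; exact: smooth_near_cst.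
have wU z : U z -> w z = 0 by move=> /UP vz; rewrite /w vz scaleN1r addNr.
have pw : (fun z => phi z *: w z) = (fun z => 0).
  apply: functional_extensionality_dep => z; have [Uz|nUz] := pselect (U z).
    by rewrite wU // scaler0.
  by rewrite (nbhs_singleton (phi0 z nUz)) scale0r.
have brw : br u w y = 0.
  have := br_leibniz y sphi su sw.
  by rewrite pw br0r // (nbhs_singleton phi1) scale1r wU // scaler0 addr0.
have -> : v = (fun z => w z + v' z).
  apply: functional_extensionality_dep => z.
  by rewrite /w addrAC scaleN1r addNr add0r.
by rewrite /br gla_br_addr // -/br brw add0r.
Qed.

Lemma br_sum_r (I : Type) (r : seq I) u (f : I -> N -> R) (w : I -> forall y, F y) y :
  gsection u -> (forall i z, smooth_near z (f i)) -> (forall i, gsection (w i)) ->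
  br u (fun z => \sum_(i <- r) f i z *: w i z) y =
  \sum_(i <- r) (f i y *: br u (w i) y + theta u (f i) y *: w i y).
Proof.
move=> su sf sw; elim: r => [|i r IH].
  rewrite big_nil -(br0r y su); congr (br u _ y).
  by apply: functional_extensionality_dep => z; rewrite big_nil.
rewrite big_cons -IH -br_leibniz // /br -gla_br_addr //; first last.
- exact: gsection_sum.
- exact: gsectionZ.
congr (gla_br G u _ y).
by apply: functional_extensionality_dep => z; rewrite big_cons.
Qed.

Lemma glob_extP u y : section_near (batlas F) y u ->
  gsection (glob_ext u y) /\ \forall z \near y, glob_ext u y z = u z.
Proof.
move=> hu; rewrite /glob_ext; case: pselect => [e|ne].
  by case: (cid e).
exfalso; apply: ne.
have [t [ht tu]] := ext_section (batlas_cover F) (@batlas_local _ _ _ F) hu.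
by exists t; split=> //; exact/gsectionP.
Qed.

Lemma bchart_atP y :
  batlas F (bchart_at (F := F) y) /\ bdom (bchart_at (F := F) y) y.
Proof. by rewrite /bchart_at; case: cid2. Qed.

Lemma gsection_pb_push (S : forall x, hF G x) :
  (forall z, section_near (hF_atlas G) z S) -> gsection (pb_push F h S).
Proof. by move=> hS; apply/gsectionP => y; exact: pb_push_section_near. Qed.

(** Both sides are expanded on global extensions of the frame at [h x] and of
    the coordinates of the two sections, which is legitimate as the bracket of
    [F] is local. *)
Lemma hF_bracket_global (S T : forall x, hF G x) x :
  (forall z, section_near (hF_atlas G) z S) ->
  (forall z, section_near (hF_atlas G) z T) ->
  hF_bracket S T x = br (pb_push F h S) (pb_push F h T) (h x).
Proof.
move=> hS hT; rewrite /hF_bracket.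
have [Fa ax] := bchart_atP (h x).
move: (bchart_at (F := F) (h x)) Fa ax => a Fa ax.
set y := h x in ax *; set u := pb_push F h S; set v := pb_push F h T.
have [su sv] := (gsection_pb_push hS, gsection_pb_push hT).
pose tau al := glob_ext (bframe a al) y.
have tauP al : gsection (tau al) /\ \forall z \near y, tau al z = bframe a al z.
  by apply: glob_extP; exact: frame_section_near (batlas_local Fa) ax.
have stau al := (tauP al).1.
have tauy al ga : bcoord a (tau al) ga y = (ga == al)%:R.
  rewrite /bcoord (nbhs_singleton (tauP al).2) -[LHS]/(bcoord a _ ga y).
  exact: bcoord_frame.
have extc (w : forall z, F z) : gsection w -> exists wt : 'I_p -> N -> R,
    (forall al z, smooth_near z (wt al)) /\
    forall al, \forall z \near y, wt al z = bcoord a w al z.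
  move=> /gsectionP hw.
  have /choice[wt wtP] al := ext_function (hw y a Fa ax al).
  by exists wt; split=> al; case: (wtP al).
have [ut [sut utE]] := extc u su; have [vt [svt vtE]] := extc v sv.
have expand (w : forall z, F z) (wt : 'I_p -> N -> R) :
    (forall al, \forall z \near y, wt al z = bcoord a w al z) ->
    \forall z \near y, w z = \sum_al wt al z *: tau al z.
  move=> wtE.
  have n1 : \forall z \near y, forall al, wt al z = bcoord a w al z.
    exact: filter_forall.
  have n2 : \forall z \near y, forall al, tau al z = bframe a al z.
    by apply: filter_forall => al; exact: (tauP al).2.
  near=> z; have az : bdom a z by near: z; exact: near_bdom.
  rewrite {1}(frame_expand (w z) az); apply: eq_bigr => al _.
  congr (_ *: _); first by rewrite (near n1 z).
  by rewrite (near n2 z).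
have bruv : br u v y = \sum_be (vt be y *:
   (- \sum_al (ut al y *: br (tau be) (tau al) y +
               theta (tau be) (ut al) y *: tau al y))
   + theta u (vt be) y *: tau be y).
  have sum_v := gsection_sum (index_enum 'I_p) svt stau.
  rewrite (near_br_r su sv sum_v (expand v vt vtE)) br_sum_r //.
  apply: eq_bigr => be _; congr (_ *: _ + _).
  rewrite br_antisym //; congr (- _).
  have sum_u := gsection_sum (index_enum 'I_p) sut stau.
  by rewrite (near_br_r (stau be) su sum_u (expand u ut utE)) br_sum_r.
apply: (@btriv_inj _ _ _ _ (pb_bchart h a)) => //.
rewrite (btrivVK (b := pb_bchart h a)) //.
apply/rowP => ga; rewrite mxE.
have hK : Defs.dinv h y = x by rewrite /y dmapK.
have push_coord (S' : forall z, hF G z) al z :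
    bcoord a (pb_push F h S') al (h z) = bcoord (pb_bchart h a) S' al z.
  by rewrite pb_push_bcoord dmapK.
have uE al : ut al y = bcoord (pb_bchart h a) S al x.
  by rewrite (nbhs_singleton (utE al)) push_coord.
have vE al : vt al y = bcoord (pb_bchart h a) T al x.
  by rewrite (nbhs_singleton (vtE al)) push_coord.
have thu f : theta u f y = hF_anchor S (f \o h) x by rewrite -hK.
have tht al f : theta (tau al) f y =
    hF_anchor (G := G) (fun z => tau al (h z)) (f \o h) x.
  by rewrite theta_opE hK.
have nh (P : N -> Prop) : (\forall z \near y, P z) -> \forall z \near x, P (h z).
  exact: (dmap_smooth h).1.
have nuE al : \forall z \near x, (ut al \o h) z = bcoord (pb_bchart h a) S al z.
  by apply: filterS (nh _ (utE al)) => z /= ->; exact: push_coord.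
have nvE al : \forall z \near x, (vt al \o h) z = bcoord (pb_bchart h a) T al z.
  by apply: filterS (nh _ (vtE al)) => z /= ->; exact: push_coord.
have TE : T x = \sum_be vt be y *: tau be (h x).
  rewrite {1}(@frame_expand _ _ _ _ (pb_bchart h a) x (T x) ax).
  apply: eq_bigr => be _; rewrite vE; congr (_ *: _).
  by rewrite (nbhs_singleton (tauP be).2).
rewrite -(near_hF_anchor T (nuE ga)) 
  (hF_anchor_sum (T := fun be z => tau be (h z)) _ TE).
rewrite -(near_hF_anchor S (nvE ga)) -thu.
have -> : btriv (pb_bchart h a) (br u v y) 0 ga = bcoord a (br u v) ga y by [].
have delta (k : 'I_p -> R) : \sum_al k al * bcoord a (tau al) ga y = k ga.
  rewrite (bigD1 ga) //= tauy eqxx mulr1 big1 ?addr0 // => al /negbTE al_ga.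
  by rewrite tauy eq_sym al_ga mulr0.
rewrite /bcoord bruv btriv_sum // summxE.
under [RHS]eq_bigr => be _.
  rewrite btrivD // !btrivZ // -scaleN1r btrivZ // btriv_sum // !mxE summxE.
  under eq_bigr => al _ do rewrite btrivD // !btrivZ // !mxE.
  rewrite big_split /= (delta (fun al => theta (tau be) (ut al) y)) tht.
  over.
rewrite big_split /= (delta (fun be => theta u (vt be) y)).
rewrite [RHS]addrC [LHS]addrAC [LHS]addrC; congr (_ + _).
under [RHS]eq_bigr => be _ do rewrite mulN1r opprD mulrDr mulrN mulrN.
rewrite big_split /= sumrN; congr (_ + _); last by rewrite sumrN.
rewrite exchange_big /= -sumrN; apply: eq_bigr => be _.
rewrite mulr_sumr -sumrN; apply: eq_bigr => al _.
rewrite -/(bcoord _ _ _ _) uE vE /structure_fun /bcoord br_antisym //.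
rewrite -scaleN1r btrivZ // mxE mulN1r !mulrN opprK mulrA.
by rewrite [X in _ = X * _]mulrC.
Unshelve. all: by end_near. Qed.

Implicit Types (S T : forall x, hF G x) (x : M).

Lemma near_hF_bracket S S' T T' x :
  (\forall z \near x, S z = S' z) -> (\forall z \near x, T z = T' z) ->
  hF_bracket S T x = hF_bracket S' T' x.
Proof.
move=> SS' TT'; rewrite /hF_bracket; congr btrivV; apply/rowP => ga; rewrite !mxE.
have co (b : bchart (hF G) p) (U V : forall z, hF G z) i :
    (\forall z \near x, U z = V z) ->
    \forall z \near x, bcoord b U i z = bcoord b V i z.
  by apply: filterS => z UV; rewrite /bcoord UV.
congr (_ + _ - _).
- apply: eq_bigr => al _; apply: eq_bigr => be _.
  rewrite (nbhs_singleton (co _ _ _ _ SS')).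
  by rewrite (nbhs_singleton (co _ _ _ _ TT')).
- rewrite (near_hF_anchor _ (co _ _ _ _ TT')).
  exact/eq_hF_anchor/(nbhs_singleton SS').
- rewrite (near_hF_anchor _ (co _ _ _ _ SS')).
  exact/eq_hF_anchor/(nbhs_singleton TT').
Qed.

Lemma ext_hF_section S x : section_near (hF_atlas G) x S -> exists S',
  (forall z, section_near (hF_atlas G) z S') /\ \forall z \near x, S' z = S z.
Proof. exact: (ext_section (@pb_cover _ _ _ _ F h) (@pb_local _ _ _ _ F h)). Qed.

(** Smoothness is inherited from the bracket of [F], on global extensions of
    the two sections. *)
Lemma section_near_bracket S T x : section_near (hF_atlas G) x S ->
  section_near (hF_atlas G) x T -> section_near (hF_atlas G) x (hF_bracket S T).
Proof.
move=> /ext_hF_section[S' [hS' SS']] /ext_hF_section[T' [hT' TT']].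
have /gsectionP hbr :=
  gla_br_smooth G (gsection_pb_push hS') (gsection_pb_push hT').
apply: (eq_section_near _ (pb_section_near (hbr (h x)))).
have [nS nT] := (near_join SS', near_join TT').
apply: filterS2 nS nT => z nS nT.
by rewrite -(near_hF_bracket nS nT) hF_bracket_global.
Qed.

Lemma hF_bracket_antisym S T x : section_near (hF_atlas G) x S ->
  section_near (hF_atlas G) x T -> hF_bracket S T x = - hF_bracket T S x.
Proof.
move=> /ext_hF_section[S' [hS' SS']] /ext_hF_section[T' [hT' TT']].
rewrite -(near_hF_bracket SS' TT') -(near_hF_bracket TT' SS').
by rewrite !hF_bracket_global // br_antisym //; exact: gsection_pb_push.
Qed.

(** The Leibniz rule, read off the formula for the bracket in a frame at [x]
    and the derivation property of the anchor. *)
Lemma hF_bracket_lin (f : M -> R) S T T' x : smooth_near x f ->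
  section_near (hF_atlas G) x T -> section_near (hF_atlas G) x T' ->
  hF_bracket S (fun z => f z *: T z + T' z) x =
  f x *: hF_bracket S T x + hF_anchor S f x *: T x + hF_bracket S T' x.
Proof.
move=> sf hT hT'; rewrite /hF_bracket.
have [Fa ax] := bchart_atP (h x).
move: (bchart_at (F := F) (h x)) Fa ax => a Fa ax.
have Pb : pb_atlas F h (pb_bchart h a) by exists a.
have bx : bdom (pb_bchart h a) x by [].
apply: (btriv_inj bx); rewrite !btrivD // !btrivZ // !(btrivVK bx).
apply/rowP => ga; rewrite !mxE.
have co i : \forall z \near x,
    bcoord (pb_bchart h a) (fun z => f z *: T z + T' z) i z =
    f z * bcoord (pb_bchart h a) T i z + bcoord (pb_bchart h a) T' i z.
  by apply: filterS (near_bdom bx) => z bz; rewrite /bcoord btriv_lin // !mxE.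
rewrite (near_hF_anchor S (co ga)).
have sT := hT _ Pb bx ga; have sT' := hT' _ Pb bx ga.
rewrite hF_anchorD // ?hF_anchorM //; last exact: smooth_nearM.
rewrite hF_anchor_lin.
pose L (U : forall z, hF G z) := \sum_al \sum_be bcoord (pb_bchart h a) S al x *
  bcoord (pb_bchart h a) U be x * structure_fun G a al be ga (h x).
have LE : L (fun z => f z *: T z + T' z) = f x * L T + L T'.
  rewrite /L mulr_sumr -big_split; apply: eq_bigr => al _ /=.
  rewrite mulr_sumr -big_split; apply: eq_bigr => be _ /=.
  by rewrite (nbhs_singleton (co be)); ring.
rewrite -!/(L _) LE -[btriv _ (T x) 0 ga]/(bcoord (pb_bchart h a) T ga x).
by ring.
Qed.

End Bracket.

(** * Gram matrices, one-forms and their differential *)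

Section SmoothMatrix.
Context {R : realType} {M : manifold R} {x : M}.

Lemma smooth_near_mulmx m n k (A : M -> 'M[R]_(m, n)) (B : M -> 'M[R]_(n, k)) :
  (forall i j, smooth_near x (fun z => A z i j)) ->
  (forall i j, smooth_near x (fun z => B z i j)) ->
  forall i j, smooth_near x (fun z => (A z *m B z) i j).
Proof.
move=> sA sB i j.
apply: eq_smooth_near (smooth_near_sum (index_enum _) predT
  (fun l => smooth_nearM (sA i l) (sB l j))).
by near=> z; rewrite mxE.
Unshelve. all: by end_near. Qed.

Lemma smooth_near_det n (A : M -> 'M[R]_n) :
  (forall i j, smooth_near x (fun z => A z i j)) ->
  smooth_near x (fun z => \det (A z)).
Proof.
move=> sA; apply: smooth_near_sum => s; apply: smooth_nearM.
  exact: smooth_near_cst.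
by apply: smooth_near_prod => i; exact: sA.
Qed.

(** Cramer's rule, near a point where the determinant does not vanish. *)
Lemma smooth_near_invmx n (A : M -> 'M[R]_n) : A x \in unitmx ->
  (forall i j, smooth_near x (fun z => A z i j)) ->
  forall i j, smooth_near x (fun z => invmx (A z) i j).
Proof.
move=> Ax sA i j; have sd := smooth_near_det sA.
have dx : \det (A x) != 0 by rewrite -unitfE -unitmxE.
have scof : smooth_near x (fun z => cofactor (A z) j i).
  apply: smooth_nearM; first exact: smooth_near_cst.
  apply: smooth_near_det => k l; apply: eq_smooth_near (sA (lift j k) (lift i l)).
  by near=> z; rewrite !mxE.
apply: eq_smooth_near (smooth_nearM (smooth_nearV dx sd) scof).
have nd : \forall z \near x, \det (A z) != 0.
  by apply: cvgr_neq0 dx; exact: (smooth_near_continuous sd).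
by apply: filterS nd => z dz; rewrite /invmx unitmxE unitfE dz !mxE.
Unshelve. all: by end_near. Qed.

End SmoothMatrix.

Lemma mulmx_trmx_eq0 (R : realType) m n (A : 'M[R]_(m, n)) : A *m A^T = 0 -> A = 0.
Proof.
move=> AA; apply/matrixP => i j; rewrite mxE.
have /matrixP/(_ i i) := AA; rewrite !mxE => /eqP.
rewrite psumr_eq0; last by move=> k _; rewrite mxE -expr2 sqr_ge0.
move=> /allP/(_ j); rewrite mem_index_enum => /(_ isT).
by rewrite mxE -expr2 sqrf_eq0 => /eqP.
Qed.

(** Over the reals, [v A A^T = 0] forces [|v A|^2 = 0]. *)
Lemma gram_unitmx (R : realType) m n (A : 'M[R]_(m, n)) :
  row_free A -> A *m A^T \in unitmx.
Proof.
move=> fA; rewrite -row_free_unit -kermx_eq0.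
have : kermx (A *m A^T) *m A = 0.
  apply: mulmx_trmx_eq0; rewrite trmx_mul !mulmxA -[X in X *m _]mulmxA.
  by rewrite mulmx_ker mul0mx.
by move/eqP; rewrite mulmx_free_eq0.
Qed.

(** Orthogonal projection to the complement of the row space of [A]. *)
Definition gram_proj (R : realType) m n (A : 'M[R]_(m, n)) (v : 'rV[R]_n) :=
  v - v *m A^T *m invmx (A *m A^T) *m A.

Lemma gram_proj_orth (R : realType) m n (A : 'M[R]_(m, n)) v : row_free A ->
  gram_proj A v *m A^T = 0.
Proof.
move=> fA; rewrite mulmxBl -[X in _ - X]mulmxA mulmxKV ?subrr //; exact: gram_unitmx.
Qed.

Lemma gram_proj_id (R : realType) m n (A : 'M[R]_(m, n)) v : v *m A^T = 0 ->
  gram_proj A v = v.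
Proof. by move=> vA; rewrite /gram_proj vA !mul0mx subr0. Qed.

Section OneForms.
Context {R : realType} {M N : manifold R} {p : nat} {F : vbundle N p}.
Variables (G : genLieAlgebroid M F) (U : set M) (b : bchart (hF G) p).
Hypotheses (oU : open U) (lb : local_bundle_chart (hF_atlas G) b) (bU : bdom b = U).
Implicit Types (S T : forall x, hF G x) (w t : hF_form G) (f : M -> R).

Notation smooth_sec S := (smooth_section (hF_atlas G) U S).

Lemma smooth_onP f : smooth_on U f <-> forall x, U x -> smooth_near x f.
Proof. by split=> [sf x Ux|]; [exists U|exact: smooth_near_on]. Qed.

Lemma smooth_sec_near S :
  smooth_sec S <-> forall x, U x -> section_near (hF_atlas G) x S.
Proof. exact: smooth_sectionP. Qed.

Lemma near_U (P : M -> Prop) x :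
  U x -> (forall y, U y -> P y) -> \forall y \near x, P y.
Proof. by move=> Ux UP; apply: filterS UP (open_nbhs_nbhs (conj oU Ux)). Qed.

Lemma smooth_sec_lin f S T : smooth_on U f -> smooth_sec S -> smooth_sec T ->
  smooth_sec (fun x => f x *: S x + T x).
Proof.
move=> /smooth_onP sf /smooth_sec_near sS /smooth_sec_near sT.
apply/smooth_sec_near => x Ux.
by apply: section_near_lin; [exact: sf|exact: sS|exact: sT].
Qed.

Lemma smooth_sec0 : smooth_sec (fun=> 0).
Proof. by apply/smooth_sec_near => x Ux; exact: section_near0. Qed.

Lemma smooth_sec_sum (I : Type) (r : seq I) (f : I -> M -> R)
    (S : I -> forall x, hF G x) : (forall i, smooth_on U (f i)) ->
  (forall i, smooth_sec (S i)) -> smooth_sec (fun x => \sum_(i <- r) f i x *: S i x).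
Proof.
move=> sf sS; apply/smooth_sec_near => x Ux; apply: section_near_sum => i.
apply: section_nearZ; first by have /smooth_onP := sf i; exact.
by have /smooth_sec_near := sS i; exact.
Qed.

Lemma smooth_sec_frame i : smooth_sec (bframe b i).
Proof.
by apply/smooth_sec_near => x Ux; apply: frame_section_near lb _; rewrite bU.
Qed.

Lemma smooth_sec_coord S i : smooth_sec S -> smooth_on U (bcoord b S i).
Proof.
move=> /smooth_sec_near sS; apply/smooth_onP => x Ux.
by apply: (section_near_coord (@pb_cover _ _ _ _ F _) _ lb); [rewrite bU|exact: sS].
Qed.

Lemma smooth_sec_bracket S T : smooth_sec S -> smooth_sec T ->
  smooth_sec (hF_bracket S T).
Proof.
move=> /smooth_sec_near sS /smooth_sec_near sT; apply/smooth_sec_near => x Ux.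
by apply: section_near_bracket; [exact: sS|exact: sT].
Qed.

Lemma smooth_sec_anchor S f : smooth_sec S -> smooth_on U f ->
  smooth_on U (hF_anchor S f).
Proof.
move=> /smooth_sec_near sS /smooth_onP sf; apply/smooth_onP => x Ux.
by apply: smooth_near_hF_anchor; [exact: sS|exact: sf].
Qed.

Lemma one_form_lin w f S T x : one_form U w -> smooth_on U f ->
  smooth_sec S -> smooth_sec T -> U x ->
  w (fun z => f z *: S z + T z) x = f x * w S x + w T x.
Proof. by case=> _ _ + sf sS sT; apply. Qed.

Lemma smooth_on_cst (k : R) : smooth_on U (fun=> k).
Proof. by apply/smooth_onP => x _; exact: smooth_near_cst. Qed.

Lemma one_form0 w x : one_form U w -> U x -> w (fun=> 0) x = 0.
Proof.
move=> hw Ux; have := one_form_lin hw (smooth_on_cst (-1)) smooth_sec0 smooth_sec0 Ux.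
rewrite mulN1r addNr => <-; case: hw => _ + _; apply=> //; first exact: smooth_sec0.
  by apply: smooth_sec_lin smooth_sec0 smooth_sec0; exact: smooth_on_cst.
by move=> z _; rewrite scaler0 addr0.
Qed.

Lemma one_form_sum w (I : Type) (r : seq I) (f : I -> M -> R)
    (S : I -> forall x, hF G x) x : one_form U w -> U x ->
  (forall i, smooth_on U (f i)) -> (forall i, smooth_sec (S i)) ->
  w (fun z => \sum_(i <- r) f i z *: S i z) x = \sum_(i <- r) f i x * w (S i) x.
Proof.
move=> hw Ux sf sS; have [_ ext _] := hw; elim: r => [|i r IH].
  rewrite big_nil -(one_form0 hw Ux); apply: ext => //.
  - exact: smooth_sec_sum.
  - exact: smooth_sec0.
  - by move=> z _; rewrite big_nil.
rewrite big_cons -IH -one_form_lin //; last exact: smooth_sec_sum.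
apply: ext => //; first exact: smooth_sec_sum.
  by apply: smooth_sec_lin => //; exact: smooth_sec_sum.
by move=> z _; rewrite big_cons.
Qed.

(** Over a trivialising open set a one-form is determined by its smooth
    coefficients in the frame, hence is pointwise. *)
Lemma one_form_frame w S x : one_form U w -> smooth_sec S -> U x ->
  w S x = \sum_i bcoord b S i x * w (bframe b i) x.
Proof.
move=> hw sS Ux; have sc i := smooth_sec_coord i sS.
rewrite -one_form_sum //; last exact: smooth_sec_frame.
have [_ ext _] := hw; apply: ext => //.
  by apply: smooth_sec_sum => //; exact: smooth_sec_frame.
by move=> z Uz; rewrite {1}(@frame_expand _ _ _ _ b z (S z)) // bU.
Qed.

Lemma eq_one_form w S T x : one_form U w -> smooth_sec S -> smooth_sec T -> U x ->
  S x = T x -> w S x = w T x.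
Proof.
move=> hw sS sT Ux ST; rewrite (one_form_frame hw sS Ux) (one_form_frame hw sT Ux).
by apply: eq_bigr => i _; rewrite /bcoord ST.
Qed.

Lemma one_form_comb (I : Type) (r : seq I) (f : I -> M -> R) (w : I -> hF_form G)
    (w0 : hF_form G) :
  (forall i, smooth_on U (f i)) -> (forall i, one_form U (w i)) ->
  one_form U w0 ->
  one_form U (fun S x => w0 S x + \sum_(i <- r) f i x * w i S x).
Proof.
move=> sf hw hw0; split.
- move=> S sS; apply/smooth_onP => x Ux; apply: smooth_nearD.
    by have [/(_ _ sS)/smooth_onP + _ _] := hw0; exact.
  apply: smooth_near_sum => i; apply: smooth_nearM.
    by have /smooth_onP := sf i; exact.
  by have [/(_ _ sS)/smooth_onP + _ _] := hw i; exact.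
- move=> S T sS sT ST x Ux; congr (_ + _).
    by have [_ + _] := hw0; apply.
  by apply: eq_bigr => i _; congr (_ * _); have [_ + _] := hw i; apply.
- move=> g S T sg sS sT x Ux; rewrite one_form_lin // mulrDr mulr_sumr addrACA.
  congr (_ + _); rewrite -big_split; apply: eq_bigr => i _ /=.
  by rewrite one_form_lin // mulrDr mulrCA.
Qed.

Section Differential.
Variables (t : hF_form G) (ht : one_form U t).

Let st S : smooth_sec S -> smooth_on U (t S).
Proof. by case: ht => + _ _; apply. Qed.

Lemma eq_d_hF S S' T x : smooth_sec S -> smooth_sec S' -> smooth_sec T -> U x ->
  (forall z, U z -> S z = S' z) -> d_hF t S T x = d_hF t S' T x.
Proof.
move=> sS sS' sT Ux SS'; have [_ ext _] := ht; rewrite /d_hF.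
rewrite (eq_hF_anchor _ (SS' x Ux)); congr (_ - _ - _).
  by apply: near_hF_anchor; apply: near_U => // z Uz; exact: ext.
apply: ext => //; try exact: smooth_sec_bracket.
by move=> z Uz; apply: near_hF_bracket; [exact: near_U|near=> y].
Unshelve. all: by end_near. Qed.

Lemma d_hF_antisym S T x : smooth_sec S -> smooth_sec T -> U x ->
  d_hF t S T x = - d_hF t T S x.
Proof.
move=> sS sT Ux; rewrite /d_hF.
have -> : t (hF_bracket S T) x = - t (hF_bracket T S) x.
  have sTS := smooth_sec_bracket sT sS; have sN := smooth_on_cst (-1).
  have := one_form_lin ht sN sTS smooth_sec0 Ux.
  rewrite (one_form0 ht Ux) addr0 mulN1r => <-.
  apply: (eq_one_form ht) => //; first exact: smooth_sec_bracket.
    exact: smooth_sec_lin smooth_sec0.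
  rewrite addr0 scaleN1r hF_bracket_antisym //.
    by have /smooth_sec_near := sS; exact.
  by have /smooth_sec_near := sT; exact.
by ring.
Qed.

(** The derivatives of the coefficient [f] coming from the anchor and from the
    Leibniz rule of the bracket cancel. *)
Lemma d_hF_lin f S T T' x : smooth_on U f -> smooth_sec S -> smooth_sec T ->
  smooth_sec T' -> U x ->
  d_hF t S (fun z => f z *: T z + T' z) x = f x * d_hF t S T x + d_hF t S T' x.
Proof.
move=> sf sS sT sT' Ux; rewrite /d_hF.
have near_x g : smooth_on U g -> smooth_near x g by move/smooth_onP; exact.
have sec_x S0 : smooth_sec S0 -> section_near (hF_atlas G) x S0.
  by move/smooth_sec_near; exact.
have -> : hF_anchor S (t (fun z => f z *: T z + T' z)) x =
    hF_anchor S (fun z => f z * t T z + t T' z) x.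
  by apply: near_hF_anchor; apply: near_U => // z Uz; exact: one_form_lin.
rewrite hF_anchorD; first last.
- exact/near_x/st.
- by apply: smooth_nearM; apply: near_x => //; exact: st.
rewrite hF_anchorM; [|exact: near_x|by apply/near_x/st].
rewrite hF_anchor_lin.
have -> : t (hF_bracket S (fun z => f z *: T z + T' z)) x =
    t (fun z => f z *: hF_bracket S T z +
      (hF_anchor S f z *: T z + hF_bracket S T' z)) x.
  have sST := smooth_sec_bracket sS sT; have sST' := smooth_sec_bracket sS sT'.
  apply: (eq_one_form ht) => //.
  - by apply: smooth_sec_bracket => //; exact: smooth_sec_lin.
  - apply: smooth_sec_lin => //; apply: smooth_sec_lin => //.
    exact: smooth_sec_anchor.
  - by rewrite hF_bracket_lin ?addrA //; [exact: near_x|exact: sec_x|exact: sec_x].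
have sST := smooth_sec_bracket sS sT; have sST' := smooth_sec_bracket sS sT'.
have sa := smooth_sec_anchor sS sf.
rewrite (one_form_lin ht sf sST (smooth_sec_lin sa sT sST') Ux).
rewrite (one_form_lin ht sa sT sST' Ux).
by ring.
Qed.

(** The differential is tensorial in its first argument by [d_hF_lin] and
    antisymmetry. *)
Lemma d_hF_one_form X : smooth_sec X -> one_form U (fun S => d_hF t S X).
Proof.
move=> sX; split.
- move=> S sS; apply/smooth_onP => x Ux.
  have near_x g : smooth_on U g -> smooth_near x g by move/smooth_onP; exact.
  apply: smooth_nearB; first apply: smooth_nearB.
  + by apply/near_x/smooth_sec_anchor/st.
  + by apply/near_x/smooth_sec_anchor/st.
  + by apply/near_x/st/smooth_sec_bracket.
- by move=> S T sS sT ST x Ux; exact: eq_d_hF.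
- move=> f S T sf sS sT x Ux; rewrite d_hF_antisym //; last exact: smooth_sec_lin.
  rewrite d_hF_lin // (d_hF_antisym sS sX Ux) (d_hF_antisym sT sX Ux).
  by rewrite opprD mulrN.
Qed.

End Differential.
End OneForms.

(** * The annihilator of a subbundle *)

Section Annihilator.
Context {R : realType} {M N : manifold R} {p r : nat} {F : vbundle N p}.
Variables (G : genLieAlgebroid M F) (E : IDS G r).
Implicit Types (S T : forall x, hF G x).

Lemma subbundle0 x : E x 0.
Proof.
have [U [s [_ Ux _ /(_ x Ux)[_ EP]]]] := sub_frame E x; apply/EP.
by exists (fun=> 0); rewrite big1 // => i _; rewrite scale0r.
Qed.

Lemma subbundleZ x k v : E x v -> E x (k *: v).
Proof.
have [U [s [_ Ux _ /(_ x Ux)[_ EP]]]] := sub_frame E x.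
move=> /EP[c ->]; apply/EP; exists (fun i => k * c i).
by rewrite scaler_sumr; apply: eq_bigr => i _; rewrite scalerA.
Qed.

(** Involutivity is a condition on global sections; a local one is made global
    with a bump function, which does not change its germ. *)
Lemma involutive_local (U : set M) S T : open U -> ids_involutive E ->
  sub_section E U S -> sub_section E U T -> forall x, U x -> E x (hF_bracket S T x).
Proof.
move=> oU inv [sS ES] [sT ET] x Ux.
have [phi [sphi phi1 phi0]] := exists_bump oU Ux.
have cut S' : smooth_section (hF_atlas G) U S' -> (forall z, U z -> E z (S' z)) ->
    sub_section E setT (fun z => phi z *: S' z).
  move=> /smooth_sectionP-/(_ oU) sS' ES'; split.
    apply/smooth_sectionP; first exact: openT.
    by move=> z _; exact: (cutoff_section sphi phi0 sS').
  move=> z _; have [Uz|nUz] := pselect (U z); first exact/subbundleZ/ES'.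
  by rewrite (nbhs_singleton (phi0 z nUz)) scale0r; exact: subbundle0.
have [_ /(_ x I)] := inv _ _ (cut S sS ES) (cut T sT ET).
rewrite (@near_hF_bracket _ _ _ _ _ _ _ S _ T) //.
  by apply: filterS phi1 => z ->; rewrite scale1r.
by apply: filterS phi1 => z ->; rewrite scale1r.
Qed.

Variables (U : set M) (b : bchart (hF G) p).
Hypotheses (oU : open U) (lb : local_bundle_chart (hF_atlas G) b) (bU : bdom b = U).

(** The coordinates of a local frame of [E] are put in the rows of a matrix, so
    that Gram matrices give orthogonal projections varying smoothly. *)
Lemma subbundle_rows x : U x -> exists (W : set M) (B : M -> 'M[R]_(r, p)),
  [/\ open W, W x, W `<=` U,
    forall z, W z -> forall i j, smooth_near z (fun y => B y i j) &
    forall z, W z -> row_free (B z) /\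
      forall v : hF G z, E z v <-> (btriv b v <= B z)%MS].
Proof.
move=> Ux; have [V [s [oV Vx ss sE]]] := sub_frame E x.
pose B z : 'M[R]_(r, p) := \matrix_(k, i) bcoord b (s k) i z.
exists (V `&` U), B; split=> //.
- exact: openI.
- move=> z [Vz Uz] i j.
  have bz : bdom b z by rewrite bU.
  have := section_near_coord (@pb_cover _ _ _ _ F _) j lb bz
    ((smooth_sectionP _ _ oV).1 (ss i) z Vz).
  by apply: eq_smooth_near; near=> y; rewrite mxE.
- move=> z [Vz Uz]; have bz : bdom b z by rewrite bU.
  have comb (c : 'I_r -> R) : btriv b (\sum_k c k *: s k z) = (\row_k c k) *m B z.
    rewrite btriv_sum // mulmx_sum_row; apply: eq_bigr => k _.
    by rewrite btrivZ // mxE; congr (_ *: _); apply/rowP => i; rewrite !mxE.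
  have [ind EP] := sE z Vz; split.
    rewrite -kermx_eq0; apply/eqP/row_matrixP => k.
    set c := row k _; rewrite row0.
    have cB : c *m B z = 0 by rewrite /c -row_mul mulmx_ker row0.
    apply/rowP => i; rewrite [RHS]mxE; apply: (ind (fun k => c 0 k)).
    apply: (btriv_inj bz); rewrite btriv0 // comb -[RHS]cB; congr (_ *m _).
    by apply/rowP => l; rewrite mxE.
  move=> v; split=> [/EP[c ->]|/submxP[c vc]].
    by rewrite comb submxMl.
  apply/EP; exists (fun k => c 0 k); apply: (btriv_inj bz); rewrite comb vc.
  by congr (_ *m _); apply/rowP => l; rewrite mxE.
Unshelve. all: by end_near. Qed.

(** The covector is extended around [x] by projecting it, at each point, to the
    orthogonal complement of [E]; a bump function makes the result a form over
    [U]. *)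
Lemma annihilator_value x (xi : 'rV[R]_p) : U x ->
  (forall v : hF G x, E x v -> xi *m (btriv b v)^T = 0) ->
  exists w, annihilator E U w /\ forall i, w (bframe b i) x = xi 0 i.
Proof.
move=> Ux xiE; have [W [B [oW Wx WU sB BE]]] := subbundle_rows Ux.
have [phi [sphi /nbhs_singleton phi1 phi0]] := exists_bump oW Wx.
pose w S z := phi z * \sum_i gram_proj (B z) xi 0 i * bcoord b S i z.
have sxi z i : W z -> smooth_near z (fun y => gram_proj (B y) xi 0 i).
  move=> Wz; have sBz := sB z Wz.
  have sBT j k : smooth_near z (fun y => (B y)^T j k).
    by apply: eq_smooth_near (sBz k j); near=> y; rewrite mxE.
  have sG := smooth_near_mulmx sBz sBT.
  have sI := smooth_near_invmx (gram_unitmx (BE z Wz).1) sG.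
  have sc j k : smooth_near z (fun=> xi j k) by exact: smooth_near_cst.
  have s := smooth_near_mulmx (smooth_near_mulmx (smooth_near_mulmx sc sBT) sI) sBz.
  apply: eq_smooth_near (smooth_nearB (sc 0 i) (s 0 i)).
  by near=> y; rewrite /gram_proj [RHS]mxE [X in _ = _ + X]mxE.
have bW z : U z -> bdom b z by rewrite bU.
have hw : one_form U w.
  split.
  - move=> S sS; apply/(smooth_onP oU) => z Uz.
    have [Wz|nWz] := pselect (W z).
      apply: smooth_nearM => //; apply: smooth_near_sum => i.
      apply: smooth_nearM; first exact: sxi.
      by have /(smooth_onP oU) := smooth_sec_coord oU lb bU i sS; exact.
    apply: eq_smooth_near (smooth_near_cst z 0).
    by apply: filterS (phi0 z nWz) => y; rewrite /w => ->; rewrite mul0r.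
  - by move=> S T _ _ ST z Uz; rewrite /w /bcoord ST.
  - move=> f S T _ _ _ z Uz; rewrite /w mulrCA -mulrDr; congr (_ * _).
    rewrite mulr_sumr -big_split; apply: eq_bigr => i _ /=.
    rewrite /bcoord btriv_lin; last exact: bW.
    by rewrite [X in _ * X]mxE [X in _ * (X + _)]mxE mulrDr mulrCA.
exists w; split; first split=> //.
  move=> S [_ ES] z Uz; rewrite /w; have [Wz|nWz] := pselect (W z); last first.
    by rewrite (nbhs_singleton (phi0 z nWz)) mul0r.
  have [fB /(_ (S z))[/(_ (ES z Uz))/submxP[c Sc] _]] := BE z Wz.
  have ortho : gram_proj (B z) xi *m (btriv b (S z))^T = 0.
    by rewrite Sc trmx_mul mulmxA gram_proj_orth // mul0mx.
  have /matrixP/(_ 0 0) := ortho; rewrite [LHS]mxE [RHS]mxE => e.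
  rewrite (_ : \sum_i _ = 0) ?mulr0 //; rewrite -[RHS]e; apply: eq_bigr => i _.
  by congr (_ * _); rewrite [RHS]mxE.
move=> i; rewrite /w phi1 mul1r gram_proj_id; last first.
  have [_ EB] := BE x Wx; apply/rowP => k; rewrite !mxE.
  have := xiE (btrivV b x (row k (B x))); rewrite EB (btrivVK (bW x Ux)).
  move=> /(_ (row_sub _ _))/matrixP/(_ 0 0); rewrite !mxE => e; rewrite -[RHS]e.
  by apply: eq_bigr => j _; rewrite !mxE.
have bx := bW x Ux; rewrite (bigD1 i) //= bcoord_frame // eqxx mulr1.
by rewrite big1 ?addr0 // => j /negbTE ji; rewrite bcoord_frame // ji mulr0.
Unshelve. all: by end_near. Qed.

Variable Theta : 'I_(p - r) -> hF_form G.
Hypothesis Theta_basis : annihilator_basis E U Theta.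

Definition coframe x : 'M[R]_(p - r, p) := \matrix_(al, i) Theta al (bframe b i) x.

Let Theta1 al : one_form U (Theta al).
Proof. by case: Theta_basis => /(_ al)[]. Qed.

Lemma coframeE S x al : smooth_section (hF_atlas G) U S -> U x ->
  Theta al S x = (btriv b (S x) *m (coframe x)^T) 0 al.
Proof.
move=> sS Ux; rewrite (one_form_frame oU lb bU (Theta1 al) sS Ux) mxE.
by apply: eq_bigr => i _; rewrite !mxE.
Qed.

Lemma conormal_sub_coframe x (xi : 'rV[R]_p) : U x ->
  (forall v : hF G x, E x v -> xi *m (btriv b v)^T = 0) -> (xi <= coframe x)%MS.
Proof.
move=> Ux /(annihilator_value Ux)[w [hw wxi]].
have [_ /(_ w hw)[f [_ wf]] _] := Theta_basis.
apply/submxP; exists (\row_al f al x); apply/rowP => i.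
rewrite -wxi wf //; last exact: smooth_sec_frame.
by rewrite mxE; apply: eq_bigr => al _; rewrite !mxE.
Qed.

(** The conormal space of [E] at [x] has dimension [p - r] and is spanned by
    the [p - r] rows of the coframe. *)
Lemma coframe_row_free x : U x -> row_free (coframe x).
Proof.
move=> Ux; have [W [B [_ Wx _ _ /(_ x Wx)[fB EB]]]] := subbundle_rows Ux.
have kerA : (kermx (B x)^T <= coframe x)%MS.
  apply/row_subP => k; apply: conormal_sub_coframe => // v /EB/submxP[c ->].
  by rewrite trmx_mul mulmxA -row_mul mulmx_ker row0 mul0mx.
move: (mxrankS kerA); rewrite mxrank_ker mxrank_tr (eqP fB) => le_pr.
by rewrite /row_free eqn_leq rank_leq_row.
Qed.

(** The component [d] of [v] orthogonal to [E] is a conormal covector, hence a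
    combination of the coframe, so that it is also orthogonal to [v]. *)
Lemma coframe_kernel x (v : hF G x) : U x ->
  btriv b v *m (coframe x)^T = 0 -> E x v.
Proof.
move=> Ux vA; have [W [B [_ Wx _ _ /(_ x Wx)[fB EB]]]] := subbundle_rows Ux.
apply/EB; set c := btriv b v in vA *; pose d := gram_proj (B x) c.
have dB : d *m (B x)^T = 0 by exact: gram_proj_orth.
have /submxP[k dk] : (d <= coframe x)%MS.
  apply: conormal_sub_coframe => // u /EB/submxP[e ->].
  by rewrite trmx_mul mulmxA dB mul0mx.
have dc : d *m c^T = 0.
  by rewrite dk -mulmxA -[_ *m c^T]trmxK trmx_mul trmxK vA trmx0 mulmx0.
have d0 : d = 0.
  apply: mulmx_trmx_eq0; rewrite {2}/d linearB /= mulmxBr dc.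
  by rewrite trmx_mul mulmxA dB mul0mx subr0.
apply/submxP; exists (c *m (B x)^T *m invmx (B x *m (B x)^T)).
by move/eqP: d0; rewrite subr_eq0 => /eqP.
Qed.

End Annihilator.

(** * Structure equations and the theorem *)

Section StructureEquations.
Context {R : realType} {M N : manifold R} {p r : nat} {F : vbundle N p}.
Variables (G : genLieAlgebroid M F) (E : IDS G r).
Variables (U : set M) (b : bchart (hF G) p).
Hypotheses (oU : open U) (lb : local_bundle_chart (hF_atlas G) b) (bU : bdom b = U).
Variable Theta : 'I_(p - r) -> hF_form G.
Hypothesis Theta_basis : annihilator_basis E U Theta.
Implicit Types (S T Y : forall x, hF G x).

Notation smooth_sec S := (smooth_section (hF_atlas G) U S).

Let Theta1 al : one_form U (Theta al).
Proof. by case: Theta_basis => /(_ al)[]. Qed.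

Let Theta0 al S x : sub_section E U S -> U x -> Theta al S x = 0.
Proof. by move=> ES Ux; case: Theta_basis => /(_ al)[_ h] _ _; exact: h. Qed.

Lemma d_hF_sub_section al S T x : sub_section E U S -> sub_section E U T -> U x ->
  d_hF (Theta al) S T x = - Theta al (hF_bracket S T) x.
Proof.
move=> ES ET Ux; rewrite /d_hF.
have zero S' T' : sub_section E U S' -> hF_anchor T' (Theta al S') x = 0.
  move=> ES'; rewrite -(hF_anchor_cst T' 0 x); apply: near_hF_anchor.
  by apply: (near_U oU) => // z Uz; exact: Theta0.
by rewrite !zero // subrr sub0r.
Qed.

(** On sections of [E] both the wedge products and the anchor terms of [d
    Theta] vanish, which leaves [Theta al [S, T] = 0]. *)
Lemma bracket_in_subbundle (Omega : 'I_(p - r) -> 'I_(p - r) -> hF_form G) :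
  (forall al S T, smooth_sec S -> smooth_sec T -> forall x, U x ->
     d_hF (Theta al) S T x = \sum_be wedge (Omega al be) (Theta be) S T x) ->
  forall S T x, sub_section E U S -> sub_section E U T -> U x ->
    E x (hF_bracket S T x).
Proof.
move=> dTheta S T x ES ET Ux; have [[sS _] [sT _]] := (ES, ET).
apply: (coframe_kernel oU lb bU Theta_basis Ux); apply/rowP => al.
rewrite -(coframeE oU lb bU Theta_basis) //; last exact: smooth_sec_bracket.
rewrite [RHS]mxE -[LHS]opprK -d_hF_sub_section // dTheta // big1 ?oppr0 //.
by move=> be _; rewrite /wedge !Theta0 // !mulr0 subrr.
Qed.

(** The frame of the orthogonal complement of [E] dual to [Theta]. *)
Definition dual_frame (be : 'I_(p - r)) (x : M) : hF G x :=
  let A := coframe b Theta x in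
  \sum_i (A^T *m invmx (A *m A^T)) i be *: bframe b i x.

Lemma smooth_dual_frame be : smooth_sec (dual_frame be).
Proof.
apply: (smooth_sec_sum oU _ _ (fun i => smooth_sec_frame oU lb bU i)) => i.
apply: smooth_near_on => x Ux.
have sA j k : smooth_near x (fun z => coframe b Theta z j k).
  have [/(_ _ (smooth_sec_frame oU lb bU k)) + _ _] := Theta1 j.
  move=> /(smooth_onP oU)/(_ x Ux).
  by apply: eq_smooth_near; near=> z; rewrite mxE.
have sAT j k : smooth_near x (fun z => (coframe b Theta z)^T j k).
  by apply: eq_smooth_near (sA k j); near=> z; rewrite [RHS]mxE.
have fA := coframe_row_free oU lb bU Theta_basis Ux.
exact: smooth_near_mulmx sAT
  (smooth_near_invmx (gram_unitmx fA) (smooth_near_mulmx sA sAT)) i be.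
Unshelve. all: by end_near. Qed.

Lemma Theta_dual_frame al be x : U x -> Theta al (dual_frame be) x = (al == be)%:R.
Proof.
move=> Ux; have bx : bdom b x by rewrite bU.
rewrite (coframeE oU lb bU Theta_basis) //; last exact: smooth_dual_frame.
set A := coframe b Theta x.
have uA : A *m A^T \in unitmx.
  exact: gram_unitmx (coframe_row_free oU lb bU Theta_basis Ux).
have -> : btriv b (dual_frame be x) = row be (A^T *m invmx (A *m A^T))^T.
  rewrite /dual_frame -/A btriv_sum // [RHS]row_sum_delta; apply: eq_bigr => i _.
  rewrite btrivZ // /bframe (btrivVK bx); congr (_ *: _).
  by rewrite [RHS]mxE [RHS]mxE.
rewrite -row_mul -trmx_mul mulmxA mulmxV // trmx1 !mxE.
by rewrite eq_sym.
Qed.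

Definition subbundle_proj S (x : M) : hF G x :=
  -1 *: (\sum_be Theta be S x *: dual_frame be x) + S x.

Let st al S : smooth_sec S -> smooth_on U (Theta al S).
Proof. by case: (Theta1 al) => + _ _; apply. Qed.

Lemma smooth_subbundle_proj S : smooth_sec S -> smooth_sec (subbundle_proj S).
Proof.
move=> sS; apply: smooth_sec_lin => //; first exact: smooth_on_cst.
apply: smooth_sec_sum => // be; first exact: st.
exact: smooth_dual_frame.
Qed.

Lemma one_form_subbundle_proj w S x : one_form U w -> smooth_sec S -> U x ->
  w (subbundle_proj S) x = w S x - \sum_be Theta be S x * w (dual_frame be) x.
Proof.
move=> hw sS Ux; rewrite /subbundle_proj.
have sD := smooth_dual_frame.
rewrite (one_form_lin hw (smooth_on_cst oU (-1))) //; last first.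
  by apply: smooth_sec_sum => // be; exact: st.
rewrite (one_form_sum oU) //; last by move=> be; exact: st.
by rewrite mulN1r addrC.
Qed.

Lemma sub_section_proj S : smooth_sec S -> sub_section E U (subbundle_proj S).
Proof.
move=> sS; split; first exact: smooth_subbundle_proj.
move=> x Ux; apply: (coframe_kernel oU lb bU Theta_basis Ux); apply/rowP => al.
rewrite -(coframeE oU lb bU Theta_basis) //; last exact: smooth_subbundle_proj.
rewrite one_form_subbundle_proj // (bigD1 al) //= Theta_dual_frame // eqxx mulr1.
rewrite big1 ?addr0 ?subrr ?mxE // => be /negbTE be_al.
by rewrite Theta_dual_frame // eq_sym be_al mulr0.
Qed.

(** The differential of [Theta al] vanishes on the projections to [E] of any two
    sections, and its values on all pairs of sections follow. The half accounts
    for the component of the differential along two vectors of the dual frame,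
    which occurs in both terms of the wedge product. *)
Lemma exists_connection_forms :
  (forall S T x, sub_section E U S -> sub_section E U T -> U x ->
     E x (hF_bracket S T x)) ->
  exists Omega : 'I_(p - r) -> 'I_(p - r) -> hF_form G,
    (forall al be, one_form U (Omega al be)) /\
    (forall al S T, smooth_sec S -> smooth_sec T -> forall x, U x ->
       d_hF (Theta al) S T x = \sum_be wedge (Omega al be) (Theta be) S T x).
Proof.
move=> invE; have sX := smooth_dual_frame.
pose d al := d_hF (Theta al).
have d1 al Y : smooth_sec Y -> one_form U (fun S => d al S Y).
  by move=> sY; exact: (d_hF_one_form oU lb bU (Theta1 al)).
have dC al S T x : smooth_sec S -> smooth_sec T -> U x -> d al S T x = - d al T S x.
  by move=> *; exact: (d_hF_antisym oU lb bU (Theta1 al)).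
exists (fun al be S x => d al S (dual_frame be) x +
  \sum_ga (- 2^-1 * d al (dual_frame ga) (dual_frame be) x) * Theta ga S x).
split=> [al be|al S T sS sT x Ux].
  pose f ga x := - 2^-1 * d al (dual_frame ga) (dual_frame be) x.
  apply: (one_form_comb oU _ (f := f) _ Theta1 (d1 al _ (sX be))) => ga.
  apply/(smooth_onP oU) => x Ux; apply: smooth_nearM; first exact: smooth_near_cst.
  by have [/(_ _ (sX ga))/(smooth_onP oU) + _ _] := d1 al _ (sX be); exact.
have dP S' T' : smooth_sec S' -> smooth_sec T' ->
    d al (subbundle_proj S') T' x =
    d al S' T' x - \sum_be Theta be S' x * d al (dual_frame be) T' x.
  by move=> sS' sT'; exact: (one_form_subbundle_proj (d1 al T' sT')).
have sPT := smooth_subbundle_proj sT.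
have d0 : d al (subbundle_proj S) (subbundle_proj T) x = 0.
  rewrite /d d_hF_sub_section //; [|exact: sub_section_proj..].
  rewrite Theta0 ?oppr0 //; split; last first.
    by move=> z Uz; apply: invE => //; exact: sub_section_proj.
  by apply: smooth_sec_bracket => //; exact: smooth_subbundle_proj.
have dr Y : smooth_sec Y -> d al Y (subbundle_proj T) x =
    d al Y T x - \sum_be Theta be T x * d al Y (dual_frame be) x.
  move=> sY; rewrite dC // dP // opprB addrC (dC _ Y T) //; congr (_ + _).
  rewrite -sumrN; apply: eq_bigr => be _.
  by rewrite (dC _ Y) // mulrN opprK.
move: d0; rewrite dP // dr //.
under [X in _ - X = 0]eq_bigr => ga _ do rewrite dr // mulrBr.
rewrite sumrB => /eqP; rewrite subr_eq0 => /eqP dST.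
pose K S' T' := \sum_ga \sum_be
  Theta ga S' x * Theta be T' x * d al (dual_frame ga) (dual_frame be) x.
have KC : K T S = - K S T.
  rewrite /K exchange_big -sumrN; apply: eq_bigr => ga _ /=.
  rewrite -sumrN; apply: eq_bigr => be _; rewrite dC //; ring.
pose D S' T' := \sum_be Theta be T' x * d al S' (dual_frame be) x.
have dE : d al S T x = D S T - D T S - K S T.
  move/eqP: dST; rewrite subr_eq => /eqP ->; rewrite -/(D S T).
  have -> : \sum_ga Theta ga S x * d al (dual_frame ga) T x = - D T S.
    rewrite /D -sumrN; apply: eq_bigr => ga _.
    by rewrite dC // mulrN.
  have -> : \sum_ga Theta ga S x *
      (\sum_be Theta be T x * d al (dual_frame ga) (dual_frame be) x) = K S T.
    apply: eq_bigr => ga _; rewrite mulr_sumr.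
    by apply: eq_bigr => be _; rewrite mulrA.
  ring.
have WE S' T' : \sum_be (d al S' (dual_frame be) x +
    \sum_ga (- 2^-1 * d al (dual_frame ga) (dual_frame be) x) *
      Theta ga S' x) * Theta be T' x = D S' T' - 2^-1 * K S' T'.
  rewrite /K exchange_big mulr_sumr -sumrB; apply: eq_bigr => be _ /=.
  rewrite mulrDl mulrC; congr (_ + _).
  rewrite mulr_suml mulr_sumr -sumrN; apply: eq_bigr => ga _; ring.
rewrite -/(d al S T x) dE /wedge sumrB !WE KC.
by field.
Qed.

End StructureEquations.

Theorem corollary5p10 (R : realType) (M N : manifold R) (p r : nat)
  (F : vbundle N p) (G : genLieAlgebroid M F) (E : IDS G r)
  (trivializing : forall c : chart R M (mdim M), matlas M c ->
     exists b : bchart (hF G) p,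
       local_bundle_chart (hF_atlas G) b /\ bdom b = cdom c)
  (Theta : chart R M (mdim M) -> 'I_(p - r) -> hF_form G)
  (Theta_basis : forall c, matlas M c -> annihilator_basis E (cdom c) (Theta c)) :
  ids_involutive E <->
  (forall c, matlas M c ->
     exists Omega : 'I_(p - r) -> 'I_(p - r) -> hF_form G,
       (forall alpha beta, one_form (cdom c) (Omega alpha beta)) /\
       (forall alpha S T,
          smooth_section (hF_atlas G) (cdom c) S ->
          smooth_section (hF_atlas G) (cdom c) T ->
          forall x, cdom c x ->
            d_hF (Theta c alpha) S T x =
            \sum_beta wedge (Omega alpha beta) (Theta c beta) S T x)).
Proof.
split=> [inv c ac|dTheta S T [sS ES] [sT ET]].
  have [b [lb bU]] := trivializing c ac; have oU := cdom_open c.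
  apply: (exists_connection_forms oU lb bU (Theta_basis c ac)) => S T x ES ET Ux.
  exact: (involutive_local oU inv ES ET).
have sec S' x : smooth_section (hF_atlas G) setT S' -> section_near (hF_atlas G) x S'.
  by move=> /(smooth_sectionP _ _ openT); exact.
split.
  apply/(smooth_sectionP _ _ openT) => x _.
  by apply: section_near_bracket; exact: sec.
move=> x _; have [c ac cx] := matlas_cover x.
have [b [lb bU]] := trivializing c ac; have oU := cdom_open c.
have [Om [_ dT]] := dTheta c ac.
have onU S' : smooth_section (hF_atlas G) setT S' ->
    (forall z, setT z -> E z (S' z)) -> sub_section E (cdom c) S'.
  move=> sS' ES'; split=> [|z _]; last exact: ES'.
  by apply/(smooth_sectionP _ _ oU) => z _; exact: sec.
by apply: (bracket_in_subbundle oU lb bU (Theta_basis c ac) dT) cx; exact: onU.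
Qed.
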